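(* Let $s\in\mathbb N$ and let $Y=\{y_i\}_{i=1}^{2s}$ with $-\pi\le y_{2s}<\dots<y_1<\pi$, extended to all $i\in\mathbb Z$ by $y_i:=y_{i+2s}+2\pi$, and put $\Pi(x):=\prod_{i=1}^{2s}\sin\frac12(x-y_i)$. Let $r\ge 2$ be an integer. There is a constant $c=c(r,Y)$, depending only on $r$ and $Y$, such that for every $f\in\Delta^{(1)}(Y)\cap\mathbb W^r$ and every $n\in\mathbb N$, $$E_n^{(1)}(f;Y)\le \frac{c}{n^r}.$$
   Context: $\mathbb W^r$ ($r\in\mathbb N$) is the class of $2\pi$-periodic functions $f:\mathbb R\to\mathbb R$ whose derivative $f^{(r-1)}$ exists and is absolutely continuous and which satisfy $|f^{(r)}(x)|\le1$ for almost every $x\in\mathbb R$. $\mathbb T_n$ is the space of real trigonometric polynomials $a_0+\sum_{k=1}^n(a_k\cos kx+b_k\sin kx)$ of order $\le n$. For a continuously differentiable function $f$ one writes $f\in\Delta^{(1)}(Y)$ if $f'(x)\Pi(x)\ge0$ for all $x\in\mathbb R$ (i.e. $f$ is nondecreasing on $[y_i,y_{i-1}]$ for odd $i$ and nonincreasing for even $i$). $E_n^{(1)}(f;Y):=\inf_{\tau\in\Delta^{(1)}(Y)\cap\mathbb T_n}\|f-\tau\|$, where $\|\cdot\|$ is the uniform norm on $\mathbb R$. *)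

(* Defs.v *)
From HB Require Import structures.
From mathcomp Require Import all_boot all_order all_algebra.
From mathcomp Require Import all_classical all_reals all_analysis.
Set Implicit Arguments. Unset Strict Implicit. Unset Printing Implicit Defensive.
Import Order.TTheory GRing.Theory Num.Theory.
Import numFieldNormedType.Exports.
Local Open Scope classical_set_scope.
Local Open Scope ring_scope.

Section Defs.
Variable R : realType.

Definition periodic2pi (f : R -> R) : Prop := forall x, f (x + 2 * pi) = f x.

Definition abs_continuous_on (a b : R) (g : R -> R) : Prop :=
  forall e : R, 0 < e -> exists2 d : R, 0 < d &
    forall (m : nat) (u v : nat -> R),
      (forall i, (i < m)%N -> a <= u i /\ u i <= v i /\ v i <= b) ->
      (forall i j, (i < m)%N -> (j < m)%N -> i <> j -> v i <= u j \/ v j <= u i) ->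
      \sum_(i < m) (v i - u i) < d ->
      \sum_(i < m) `|g (v i) - g (u i)| < e.

Definition abs_continuous (g : R -> R) : Prop :=
  forall a b : R, abs_continuous_on a b g.

Definition W (r : nat) (f : R -> R) : Prop :=
  [/\ periodic2pi f,
      (forall k, (k < r.-1)%N -> forall x, derivable (derive1n k f) x 1),
      abs_continuous (derive1n r.-1 f) &
      {ae (@lebesgue_measure R), forall x,
          derivable (derive1n r.-1 f) x 1 /\ `|derive1n r f x| <= 1}].

Definition trig_poly (n : nat) (t : R -> R) : Prop :=
  exists a b : nat -> R, forall x,
    t x = a 0%N + \sum_(1 <= k < n.+1) (a k * cos (k%:R * x) + b k * sin (k%:R * x)).

Definition PiY (s : nat) (y : nat -> R) (x : R) : R :=
  \prod_(1 <= i < (2 * s).+1) sin ((x - y i) / 2).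

Definition Delta1 (s : nat) (y : nat -> R) (f : R -> R) : Prop :=
  [/\ forall x, derivable f x 1, continuous (derive1 f) &
      forall x, 0 <= derive1 f x * PiY s y x].

Definition unorm (g : R -> R) : \bar R :=
  ereal_sup [set (`|g x|)%:E | x in [set: R]].

Definition En1 (n s : nat) (y : nat -> R) (f : R -> R) : \bar R :=
  ereal_inf [set unorm (fun x => f x - t x) | t in [set t | Delta1 s y t /\ trig_poly n t]].

Definition admissibleY (s : nat) (y : nat -> R) : Prop :=
  [/\ -pi <= y (2 * s)%N,
      (forall i, (1 <= i)%N -> (i < 2 * s)%N -> y i.+1 < y i) &
      y 1%N < pi].
End Defs.

(* Main.v *)
Require Import Defs.
From HB Require Import structures.
From mathcomp Require Import all_boot all_order all_algebra.
From mathcomp Require Import all_classical all_reals all_analysis.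
From mathcomp Require Import ring lra.
Import Order.TTheory GRing.Theory Num.Theory.
Import numFieldNormedType.Exports.
Local Open Scope classical_set_scope.
Local Open Scope ring_scope.
Set Implicit Arguments. Unset Strict Implicit. Unset Printing Implicit Defensive.

(** Put [g = f'], so that [g Pi >= 0], and let [phi_j] be translates of a power of the Fejer
    kernel of order [~ n], normalised to a nonnegative trigonometric partition of unity centred
    at equidistant nodes [x_j]. Near [x_j] the function [g] is approximated to order
    [n^(1 - r)], with polynomially growing weights, by a trigonometric polynomial [p_j] of
    bounded order, chosen so that [p_j] has the sign of [Pi] everywhere and [|p_j| >= |g|].
    Then [theta_j = int |g| phi_j / int |p_j| phi_j] lies in [[0, 1]], so
    [q = sum_j theta_j p_j phi_j] still has the sign of [Pi], and [theta_j p_j] is still a good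
    local approximation because [p_j], having bounded order, is controlled by
    [int |p_j| phi_j]. The choice of [theta_j] makes [int (theta_j p_j - g) phi_j] vanish up to
    the contribution of the points beyond the nearest zero of [Pi], so this integral is
    [O(n^-r)] with summable decay in the distance from [x_j] to the zeros. Hence the integral of
    [q - g] over [[0, x]] is [O(n^-r)] uniformly in [x]. The mean of [q], itself [O(n^-r)], is
    removed with a fixed trigonometric polynomial that has the sign of [Pi] and a mean of the
    required sign; the latter is obtained by the same construction from the positive and
    negative parts of [Pi]. *)

(** A uniform approximation of [g] of order n^(1 - r) loses a power of n when it is integrated; that
    power has to come from cancellation inside each cell. The obstacle is the sign condition, which
    an additive correction of a cell would destroy. Scaling by a factor in [0, 1] keeps the sign but
    can only shrink [p_j], which is why [p_j] is first made to overshoot [|g|]. The overshoot must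
    vanish with [Pi], so near a zero the error has to be small relative to the distance to that
    zero; this is why the local approximations are made to interpolate [g] there. Absolute values
    are balanced because on the part of the circle where [Pi] has the sign of [Pi(x_j)] they differ
    from the functions by one constant sign only. The decay of the cell defects away from the zeros
    is essential: there are about n nodes, and a bare bound n^(-r) for each of them would add up to
    n^(1 - r). *)

(** Integrals are handled as increments of antiderivatives, so that integral inequalities reduce to
    the mean value theorem. *)
Definition der {R : realType} (F u : R -> R) := forall x : R, is_derive x 1 F (u x).

(** * Antiderivatives, mean value estimates and the sine as a periodic distance *)

Section Calculus.
Variable R : realType.
Implicit Types (F G u v : R -> R) (a b c x y : R).

Lemma der_ext F u v : (forall x, u x = v x) -> der F u -> der F v.
Proof. by move=> e dF x; rewrite -e. Qed.

Lemma der_cst c : der (fun=> c) (fun=> 0).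
Proof. by move=> x; exact: is_derive_cst. Qed.

Lemma der_id : der (fun x : R => x) (fun=> 1).
Proof. by move=> x; exact: is_derive_id. Qed.

Lemma derD F G u v : der F u -> der G v -> der (fun x => F x + G x) (fun x => u x + v x).
Proof. by move=> dF dG x; exact: (is_deriveD (dF x) (dG x)). Qed.

Lemma derN F u : der F u -> der (fun x => - F x) (fun x => - u x).
Proof. by move=> dF x; exact: (is_deriveN (dF x)). Qed.

Lemma derB F G u v : der F u -> der G v -> der (fun x => F x - G x) (fun x => u x - v x).
Proof. by move=> dF dG x; exact: (is_deriveB (dF x) (dG x)). Qed.

Lemma derZ c F u : der F u -> der (fun x => c * F x) (fun x => c * u x).
Proof. by move=> dF x; exact: (is_deriveZ c (dF x)). Qed.

Lemma der_comp F G u v : der F u -> der G v ->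
  der (fun x => F (G x)) (fun x => v x * u (G x)).
Proof.
move=> dF dG x; have := @is_derive1_comp R F G x _ _ (dF (G x)) (dG x).
by rewrite mulrC.
Qed.

Lemma der_affine b c F u : der F u -> der (fun x => F (c * x + b)) (fun x => c * u (c * x + b)).
Proof.
move=> dF; have h : der (fun x => c * x + b) (fun=> c).
  apply: der_ext (derD (derZ c der_id) (der_cst b)) => x /=.
  by rewrite mulr1 addr0.
exact: der_comp dF h.
Qed.

Lemma der_sum (I : Type) (s : seq I) (P : pred I) (F u : I -> R -> R) :
  (forall i, der (F i) (u i)) ->
  der (fun x => \sum_(i <- s | P i) F i x) (fun x => \sum_(i <- s | P i) u i x).
Proof.
move=> dF; elim: s => [|i s IH].
  have -> : (fun x => \sum_(i <- [::] | P i) F i x) = fun=> 0.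
    by apply: funext => x; rewrite big_nil.
  by apply: der_ext (der_cst 0) => x; rewrite big_nil.
case: (boolP (P i)) => Pi.
  have -> : (fun x => \sum_(j <- i :: s | P j) F j x) =
            fun x => F i x + \sum_(j <- s | P j) F j x.
    by apply: funext => x; rewrite big_cons Pi.
  by apply: der_ext (derD (dF i) IH) => x; rewrite big_cons Pi.
have -> : (fun x => \sum_(j <- i :: s | P j) F j x) =
          fun x => \sum_(j <- s | P j) F j x.
  by apply: funext => x; rewrite big_cons (negbTE Pi).
by apply: der_ext IH => x; rewrite big_cons (negbTE Pi).
Qed.

Lemma der_continuous F u : der F u -> continuous F.
Proof.
move=> dF x; apply: differentiable_continuous.
by apply/derivable1_diffP; exact: ex_derive.
Qed.

Lemma der_within F u a b : der F u -> {within `[a, b], continuous F}.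
Proof. by move=> dF; apply: continuous_subspaceT => x; exact: der_continuous dF x. Qed.

Lemma der_MVT F u a b : der F u -> a <= b ->
  exists2 c, a <= c <= b & F b - F a = u c * (b - a).
Proof.
move=> dF ab; have [||c + e] := @MVT_segment R F u a b ab.
- by move=> x _; exact: dF.
- exact: der_within dF.
- by rewrite in_itv /= => cab; exists c.
Qed.

Lemma der_le F G u v a b : der F u -> der G v -> a <= b ->
  (forall x, a <= x <= b -> u x <= v x) -> F b - F a <= G b - G a.
Proof.
move=> dF dG ab uv.
have [c cab e] := der_MVT (derB dG dF) ab.
rewrite -subr_ge0; have -> : G b - G a - (F b - F a) = G b - F b - (G a - F a) by ring.
by rewrite e mulr_ge0 // subr_ge0 // uv.
Qed.

Lemma der_mono F u x y : der F u -> (forall t, 0 <= u t) -> x <= y -> F x <= F y.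
Proof.
move=> dF u0 xy; rewrite -subr_ge0; have := der_le (der_cst 0) dF xy (fun t _ => u0 t).
by rewrite subrr.
Qed.

(** Equal end values would make the monotone function [F] constant on [a, b], with zero derivative
    at [c]. *)
Lemma der_lt F u a b c : der F u -> (forall t, 0 <= u t) -> a < c < b -> 0 < u c -> F a < F b.
Proof.
move=> dF u0 /andP[ac cb] uc; have mono x y := @der_mono F u x y dF u0.
rewrite lt_neqAle mono ?(ltW (lt_trans ac cb)) // andbT; apply/eqP => eF.
have d0 : is_derive c 1 F 0.
  apply: (@near_eq_is_derive _ _ _ (fun=> F a)).
  near=> x; have ax : F a <= F x by apply/mono/ltW; near: x; exact: lt_nbhsr.
  have xb : F x <= F b by apply/mono/ltW; near: x; exact: lt_nbhsl.
  by apply/eqP; rewrite eq_le ax eF.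
have := dF c => /@derive_val; rewrite (@derive_val _ _ _ _ _ _ _ d0) => e.
by move: uc; rewrite -e ltxx.
Unshelve. all: by end_near.
Qed.

Lemma der_norm_le F G u v a b : der F u -> der G v -> a <= b ->
  (forall x, a <= x <= b -> `|u x| <= v x) -> `|F b - F a| <= G b - G a.
Proof.
move=> dF dG ab uv; rewrite ler_norml; apply/andP; split.
  rewrite lerNl; have -> : - (F b - F a) = - F b - - F a by ring.
  apply: der_le (derN dF) dG ab _ => x /uv.
  by rewrite ler_norml lerNl => /andP[].
by apply: der_le dF dG ab _ => x /uv; rewrite ler_norml => /andP[].
Qed.

Lemma der_lip F u a b C : der F u -> (forall x, Num.min a b <= x <= Num.max a b -> `|u x| <= C) ->
  `|F b - F a| <= C * `|b - a|.
Proof.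
move=> dF uC; wlog ab : a b uC / a <= b => [hw|].
  case: (leP a b) => [|/ltW] ab; first exact: hw.
  by rewrite distrC (distrC b); apply: hw => // x; rewrite minC maxC; exact: uC.
rewrite (ger0_norm (x := b - a)) ?subr_ge0 // mulrBr.
have dC : der (fun x : R => C * x) (fun=> C).
  by apply: der_ext (derZ C der_id) => x; rewrite mulr1.
apply: (der_norm_le dF dC ab).
by move=> x h; apply: uC; rewrite (min_idPl ab) (max_idPr ab).
Qed.

Lemma der_eq F G u a b : der F u -> der G u -> F b - F a = G b - G a.
Proof.
move=> dF dG; apply/eqP; rewrite -subr_eq0 -normr_le0.
have := @der_lip _ _ a b 0 (derB dF dG).
rewrite mul0r.
have -> : F b - G b - (F a - G a) = F b - F a - (G b - G a) by ring.
by apply=> x _; rewrite subrr normr0.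
Qed.

Lemma der_sin : der (@sin R) (@cos R).
Proof. by move=> x; exact: is_derive_sin. Qed.

Lemma der_cos : der (@cos R) (fun x => - sin x).
Proof. by move=> x; exact: is_derive_cos. Qed.

Lemma der_atan : der (@atan R) (fun x => (1 + x ^+ 2)^-1).
Proof. by move=> x; exact: is_derive1_atan. Qed.

(* The base point of the integral is moved to [-n-1] on [[-n, n]], and the pieces are normalised at 0. *)
Lemma antiderivative u : continuous u -> exists U, der U u.
Proof.
move=> cu.
pose V n y := (\int[@lebesgue_measure R]_(t in `[(- n%:R - 1)%R, y]) u t)%R.
have dV n x : - n%:R - 1 < x -> is_derive x 1 (V n) (u x).
  move=> nx; have xx : x < x + 1 by rewrite ltrDl.
  have int : (@lebesgue_measure R).-integrable `[(- n%:R - 1), x + 1] (EFin \o u).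
    apply: continuous_compact_integrable; first exact: segment_compact.
    by apply: continuous_subspaceT => z; exact: cu.
  have [d1 <-] := continuous_FTC1_closed xx int nx (cu x).
  by rewrite derive1E; exact: derivableP.
pose W n y := V n y - V n 0.
have dW : forall n x, - n%:R - 1 < x -> is_derive x 1 (W n) (u x).
  move=> n x /dV h; rewrite -[u x]subr0; apply: is_deriveB.
have eW n m x : (n <= m)%N -> - n%:R - 1 < x -> W n x = W m x.
  move=> nm nx.
  have nm' : - m%:R - 1 <= - n%:R - 1 :> R by rewrite lerB // lerN2 ler_nat.
  have key a b : a <= b -> - n%:R - 1 < a -> W n b - W m b = W n a - W m a.
    move=> ab na.
    have d y : a <= y -> is_derive y 1 (W n \- W m) 0.
      move=> ay; rewrite -[0](subrr (u y)).
      apply: is_deriveB; apply: dW; first exact: lt_le_trans ay.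
      exact: le_lt_trans nm' (lt_le_trans na ay).
    have [||c _] := @MVT_segment R (W n \- W m) (fun=> 0) a b ab.
    - by move=> y; rewrite in_itv /= => /andP[/ltW ay _]; exact: d.
    - apply: derivable_within_continuous => y.
      by rewrite in_itv /= => /andP[ay _]; exact: (@ex_derive _ _ _ _ _ _ _ (d _ ay)).
    - by rewrite mul0r /= => /eqP; rewrite subr_eq0 => /eqP.
  have W0 p : W p 0 = 0 by rewrite /W subrr.
  have n0 : - n%:R - 1 < 0 :> R by have := ler0n R n; lra.
  case: (leP 0 x) => [x0|/ltW x0].
    by have := key 0 x x0 n0; rewrite !W0; lra.
  by have := key x 0 x0 nx; rewrite !W0; lra.
pose N x := Num.truncn `|x|.
have xN x : - (N x).+1%:R < x.
  by rewrite ltrNl; apply: le_lt_trans (truncnS_gt _); rewrite -normrN ler_norm.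
exists (fun x => W (N x).+2 x) => x.
(* For |z - x| < 1 one has [N z <= (N x).+1], so the fixed index [(N x).+3] serves a whole
   neighbourhood of [x]. *)
have h : is_derive x 1 (W (N x).+3) (u x).
  by apply: dW; apply: lt_trans (xN x); rewrite -(addn2 (N x).+1) natrD; lra.
apply: (near_eq_is_derive (f := W (N x).+3)) => //.
near=> z; apply: esym.
have zx : `|x - z| < 1 by near: z; exact: (@nbhsx_ballx R R^o x 1 ltr01).
have hz : `|z| < `|x| + 1.
  by have := ler_distD x z 0; rewrite !subr0 distrC; lra.
apply: eW.
  rewrite !ltnS /N real_truncn_le_nat ?num_real //; apply: lt_trans hz _.
  by rewrite -[X in _ < X%:R]addn1 natrD ltrD2r; exact: truncnS_gt.
by have := xN z; rewrite -[(N z).+2]addn1 natrD; lra.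
Unshelve. all: by end_near.
Qed.

Lemma norm_sin_le x : `|sin x| <= `|x|.
Proof.
have := @der_lip _ _ 0 x 1 der_sin; rewrite sin0 !subr0 mul1r.
by apply=> y _; exact: cos_max.
Qed.

Lemma cos_ge_quadratic x : 1 - x ^+ 2 / 2 <= cos x.
Proof.
have -> : cos x = 1 - 2 * sin (x / 2) ^+ 2.
  rewrite {1}(_ : x = (x / 2) *+ 2) ?cos_mulr2n ?cos2sin2; last by rewrite mulr2n; lra.
  by rewrite mulr2n; ring.
have : `|sin (x / 2)| ^+ 2 <= `|x / 2| ^+ 2.
  by rewrite lerXn2r ?nnegrE ?normr_ge0 // norm_sin_le.
by rewrite !real_normK ?num_real // expr_div_n; lra.
Qed.

(** On [0, 1] the cosine is at least 1/2; beyond 1 the sine is at least sin 1 >= 1/2, while x <= pi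
    / 2 < 2. *)
Lemma sin_ge_quarter x : 0 <= x <= pi / 2 -> x / 4 <= sin x.
Proof.
move=> /andP[x0 xp].
have h1 y : 0 <= y <= 1 -> y / 2 <= sin y.
  move=> /andP[y0 y1]; have [c /andP[c0 cy]] := der_MVT der_sin y0.
  rewrite sin0 !subr0 => ->.
  have := cos_ge_quadratic c; have : c ^+ 2 <= 1 by rewrite expr_le1 //; lra.
  by nra.
case: (leP x 1) => x1; first by have := h1 x; rewrite x0 x1 => /(_ isT); lra.
have p2 : pi / 2 < 2 :> R := pihalf_lt2 R.
have s1 : 1 / 2 <= sin (1 : R) by apply: h1; lra.
have : sin 1 <= sin x.
  rewrite le_eqVlt ltr_sin ?x1 ?orbT // in_itv /=; lra.
by lra.
Qed.

Lemma norm_le_sin_half x : `|x| <= pi -> `|x| <= 8 * `|sin (x / 2)|.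
Proof.
wlog x0 : x / 0 <= x => [hw|].
  case: (leP 0 x) => [|/ltW] x0; first exact: hw.
  by have := hw (- x); rewrite oppr_ge0 mulNr sinN !normrN; exact.
rewrite (ger0_norm x0) => xp.
have h : 0 <= x / 2 <= pi / 2 by lra.
by have := sin_ge_quarter h; have := ler_norm (sin (x / 2)); lra.
Qed.

Lemma periodic2piz F x (z : int) : periodic2pi F -> F (x + 2 * pi * z%:~R) = F x.
Proof.
move=> pF.
have pn n y : F (y + 2 * pi * n%:R) = F y.
  elim: n y => [|n IH] y; first by rewrite mulr0 addr0.
  by rewrite -[n.+1]addn1 natrD mulrDr mulr1 addrA pF IH.
case: z => n; first exact: pn.
rewrite NegzE mulrNz mulrN -(pn n.+1 (x - 2 * pi * n.+1%:R)) subrK //.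
Qed.

(** Lets a periodic estimate be proved with the ordinary distance to [a], which [norm_le_sin_half]
    then compares with [sin ((x - a) / 2)]. *)
Lemma near_mod_2pi a x : exists z : int, `|x + 2 * pi * z%:~R - a| <= pi.
Proof.
have p0 : 0 < pi :> R := pi_gt0 R.
have p0' : pi != 0 :> R by rewrite gt_eqF.
set t := (x - a) / (2 * pi) + 1 / 2.
exists (- Num.floor t); rewrite mulrNz mulrN.
have /andP[] := floor_itv t; set z : R := (Num.floor t)%:~R; rewrite intrD mulr1z -/z => h1 h2.
have -> : x - 2 * pi * z - a = 2 * pi * (t - 1 / 2 - z).
  by rewrite /t; move: (pi) p0' => p p0'; field.
rewrite normrM ger0_norm; last by lra.
have : `|t - 1 / 2 - z| <= 1 / 2 by rewrite ler_norml; lra.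
by nra.
Qed.

Lemma periodic_norm_sin_half : periodic2pi (fun x : R => `|sin (x / 2)|).
Proof. by move=> x; rewrite mulrDl [2 * pi]mulrC mulfK // sinDpi normrN. Qed.

Lemma norm_sin_half_shift x a (z : int) :
  `|sin ((x + 2 * pi * z%:~R - a) / 2)| = `|sin ((x - a) / 2)|.
Proof. by rewrite addrAC (periodic2piz _ _ periodic_norm_sin_half). Qed.

End Calculus.

(** * Homogeneous forms in the half-angle and their growth off interpolation nodes *)

Section HalfAngleForms.
Variable R : realType.
Implicit Types (p q u v : R -> R) (a b c x y : R) (m n k : nat).

(* Homogeneous forms of degree [m] in [cos (x / 2)] and [sin (x / 2)]; those of even degree
   [2n] are the trigonometric polynomials of order [<= n]. *)
Fixpoint half_form m p : Prop :=
  if m is m'.+1 then exists u v, [/\ half_form m' u, half_form m' v &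
    p = fun x => cos (x / 2) * u x + sin (x / 2) * v x]
  else exists c, p = fun=> c.

Lemma half_formD m p q : half_form m p -> half_form m q -> half_form m (fun x => p x + q x).
Proof.
elim: m p q => [|m IH] p q /=.
  by move=> [c ->] [d ->]; exists (c + d).
move=> [u [v [hu hv ->]]] [u' [v' [hu' hv' ->]]].
exists (fun x => u x + u' x), (fun x => v x + v' x); split; [exact: IH|exact: IH|].
by apply: funext => x; ring.
Qed.

Lemma half_formZ m c p : half_form m p -> half_form m (fun x => c * p x).
Proof.
elim: m p => [|m IH] p /=; first by move=> [d ->]; exists (c * d).
move=> [u [v [hu hv ->]]].
exists (fun x => c * u x), (fun x => c * v x); split; [exact: IH|exact: IH|].
by apply: funext => x; ring.
Qed.

Lemma half_form0 m : half_form m (fun=> 0).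
Proof.
elim: m => [|m IH] /=; first by exists 0.
by exists (fun=> 0), (fun=> 0); split => //; apply: funext => x; rewrite !mulr0 addr0.
Qed.

Lemma half_formMcos m p : half_form m p -> half_form m.+1 (fun x => cos (x / 2) * p x).
Proof.
move=> hp; exists p, (fun=> 0); split => //; first exact: half_form0.
by apply: funext => x; rewrite mulr0 addr0.
Qed.

Lemma half_formMsin m p : half_form m p -> half_form m.+1 (fun x => sin (x / 2) * p x).
Proof.
move=> hp; exists (fun=> 0), p; split => //; first exact: half_form0.
by apply: funext => x; rewrite mulr0 add0r.
Qed.

Lemma half_formM m n p q : half_form m p -> half_form n q ->
  half_form (m + n) (fun x => p x * q x).
Proof.
elim: m p => [|m IH] p /=; first by move=> [c ->] hq; exact: half_formZ.
move=> [u [v [hu hv ->]]] hq.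
exists (fun x => u x * q x), (fun x => v x * q x); split; [exact: IH|exact: IH|].
by apply: funext => x; ring.
Qed.

Lemma half_form_shift m p a : half_form m p -> half_form m (fun x => p (x + a)).
Proof.
elim: m p => [|m IH] p /=; first by move=> [c ->]; exists c.
move=> [u [v [/IH hu /IH hv ->]]].
exists (fun x => cos (a / 2) * u (x + a) + sin (a / 2) * v (x + a)),
  (fun x => - sin (a / 2) * u (x + a) + cos (a / 2) * v (x + a)).
split; [by apply: half_formD; apply: half_formZ|by apply: half_formD; apply: half_formZ|].
by apply: funext => x; rewrite mulrDl cosD sinD; ring.
Qed.

Lemma half_form_sin y : half_form 1 (fun x => sin ((x - y) / 2)).
Proof.
exists (fun=> - sin (y / 2)), (fun=> cos (y / 2)); split.
- by exists (- sin (y / 2)).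
- by exists (cos (y / 2)).
- by apply: funext => x; rewrite mulrBl sinB; ring.
Qed.

Lemma half_form_cst n c : half_form n.*2 (fun=> c).
Proof.
elim: n => [|n IH]; first by exists c.
have h := half_formD (half_formMcos (half_formMcos IH)) (half_formMsin (half_formMsin IH)).
rewrite doubleS (_ : (fun=> c) = fun x => cos (x / 2) * (cos (x / 2) * c)
  + sin (x / 2) * (sin (x / 2) * c)) //.
by apply: funext => x; rewrite !mulrA -mulrDl -!expr2 cos2Dsin2 mul1r.
Qed.

Lemma half_form_widen m n p : half_form m p -> half_form (m + n.*2) p.
Proof.
move=> hp; have := half_formM hp (half_form_cst n 1).
by congr half_form; apply: funext => x; rewrite mulr1.
Qed.

(** Homogeneous analogue of dividing a polynomial by its variable: the only monomial without the
    factor [sin (x / 2)] is the pure power of [cos (x / 2)]. *)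
Lemma half_form_div m p : half_form m.+1 p ->
  exists c q, half_form m q /\ p = fun x => c * cos (x / 2) ^+ m.+1 + sin (x / 2) * q x.
Proof.
elim: m p => [|m IH] p /=.
  move=> [_ [v [[c ->] hv ->]]]; exists c, v; split => //.
  by apply: funext => x; rewrite expr1 mulrC.
move=> [u [v [/IH [c [q [hq ->]]] hv ->]]].
exists c, (fun x => cos (x / 2) * q x + v x); split.
  exact: (@half_formD m.+1 _ _ (half_formMcos hq) hv).
by apply: funext => x; rewrite [_ ^+ m.+2]exprS; ring.
Qed.

(* Newton interpolation at [m + 1] nodes separated on the scale [h]. *)
Lemma half_form_growth m (d : R) : 0 < d -> exists2 C : R, 0 <= C &
  forall p, half_form m p -> forall (h a B : R) (t : nat -> R), 0 < h -> 0 <= B ->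
  (forall i, (i <= m)%N -> `|sin ((t i - a) / 2)| <= h) ->
  (forall i j, (i < j <= m)%N -> d * h <= `|sin ((t j - t i) / 2)|) ->
  (forall i, (i <= m)%N -> `|p (t i)| <= B) ->
  forall x, `|p x| <= C * B * (1 + `|sin ((x - a) / 2)| / h) ^+ m.
Proof.
move=> d0; elim: m => [|m [C C0 IH]].
  exists 1 => // p [c ->] h a B t _ _ _ _ /(_ 0%N isT) hB x.
  by rewrite expr0 mulr1 mul1r.
(* The 1 pays for the cosine remainder, whose coefficient is the value of [p] at [t 0]. The rest
   pays for the quotient, which is at most 2 B / (d h) at the remaining nodes. *)
exists (1 + 2 * (C * (2 / d))).
  by rewrite addr_ge0 // !mulr_ge0 // invr_ge0 ltW.
move=> p hp h a B t h0 B0 ht hd hB x.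
have [c [q [hq ep]]] := half_form_div (half_form_shift (t 0%N) hp).
have {}ep y : p y = c * cos ((y - t 0%N) / 2) ^+ m.+1 + sin ((y - t 0%N) / 2) * q (y - t 0%N).
  by have := congr1 (fun f => f (y - t 0%N)) ep; rewrite /= subrK.
have cB : `|c| <= B.
  have := hB 0%N isT; rewrite ep subrr mul0r cos0 sin0 expr1n mulr1 mul0r addr0.
  by [].
have ccos (y : R) : `|c * cos y ^+ m.+1| <= B.
  rewrite normrM normrX; apply: le_trans cB.
  by rewrite ler_piMr // exprn_ile1 ?normr_ge0 // cos_max.
have sa y : `|sin ((y - t 0%N) / 2)| <= `|sin ((y - a) / 2)| + h.
  have -> : (y - t 0%N) / 2 = (y - a) / 2 - (t 0%N - a) / 2 by lra.
  rewrite sinB; apply: (le_trans (ler_normB _ _)); rewrite !normrM; apply: lerD.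
    by rewrite ler_piMr // cos_max.
  by apply: le_trans (ht 0%N isT); rewrite ler_piMl // cos_max.
have := IH _ (half_form_shift (- t 0%N) hq) h a (2 / d / h * B) (fun i => t i.+1) h0.
have B0' : 0 <= 2 / d / h * B by rewrite !mulr_ge0 // invr_ge0 ltW.
move=> /(_ B0') hx.
have {hx} : `|q (x - t 0%N)| <= C * (2 / d / h * B) * (1 + `|sin ((x - a) / 2)| / h) ^+ m.
  apply: hx => [i im|i j /andP[ij jm]|i im].
  - exact: ht.
  - by apply: hd; rewrite !ltnS ij.
  - have := hB i.+1 im; have := hd 0%N i.+1 im; have := ccos ((t i.+1 - t 0%N) / 2).
    rewrite ep; set s := sin _; set e := c * _; set w := q _ => he hs hp'.
    have sw : `|s| * `|w| <= 2 * B.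
      rewrite -normrM (_ : s * w = e + s * w - e); last by ring.
      by apply: (le_trans (ler_normB _ _)); rewrite mulr2n mulrDl mul1r lerD.
    have s0 : 0 < `|s| by apply: lt_le_trans hs; rewrite mulr_gt0.
    have -> : 2 / d / h * B = 2 * B / (d * h) by field; rewrite !gt_eqF.
    rewrite ler_pdivlMr ?mulr_gt0 // mulrC; apply: le_trans sw.
    by rewrite ler_wpM2r.
set s := `|sin ((x - a) / 2)|; set w := q _ => hw.
have z1 : 1 <= 1 + s / h by rewrite lerDl divr_ge0 ?normr_ge0 ?ltW.
rewrite ep; apply: (le_trans (ler_normD _ _)); rewrite [X in _ + X]normrM.
rewrite [leRHS](_ : _ = B * (1 + s / h) ^+ m.+1 +
  2 * (C * (2 / d)) * B * (1 + s / h) ^+ m.+1); last by rewrite !mulrDl !mul1r.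
apply: lerD.
  by apply: (le_trans (ccos _)); rewrite ler_peMr // exprn_ege1.
have sh : `|sin ((x - t 0%N) / 2)| <= h * (1 + s / h).
  rewrite (_ : h * (1 + s / h) = s + h); first exact: sa.
  by field; rewrite gt_eqF.
apply: (le_trans (ler_pM _ _ sh hw)) => //.
have E0 : 0 <= (1 + s / h) ^+ m by rewrite exprn_ge0 // (le_trans ler01).
set E := (_ ^+ m) in E0 *; rewrite exprS -/E.
have -> : h * (1 + s / h) * (C * (2 / d / h * B) * E) =
  (C * (2 / d) * B * ((1 + s / h) * E)) * (h / h) by field; rewrite !gt_eqF.
rewrite mulfV ?gt_eqF // mulr1.
have : 0 <= C * (2 / d) * B * ((1 + s / h) * E).
  by rewrite !mulr_ge0 // ?invr_ge0 ?ltW // (lt_le_trans ltr01).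
by rewrite -!mulrA; lra.
Qed.

End HalfAngleForms.

(** * Closure properties of trigonometric polynomials *)

Section TrigPolynomials.
Variable R : realType.
Implicit Types (t u v : R -> R) (a b c x y : R) (m n k : nat).

Lemma trig_polyD n t u : trig_poly n t -> trig_poly n u -> trig_poly n (fun x => t x + u x).
Proof.
move=> [a [b et]] [a' [b' eu]].
exists (fun k => a k + a' k), (fun k => b k + b' k) => x.
rewrite et eu addrACA -big_split; congr (_ + _); apply: eq_bigr => k _ /=; ring.
Qed.

Lemma trig_polyZ n c t : trig_poly n t -> trig_poly n (fun x => c * t x).
Proof.
move=> [a [b et]]; exists (fun k => c * a k), (fun k => c * b k) => x.
rewrite et mulrDr mulr_sumr; congr (_ + _); apply: eq_bigr => k _ /=; ring.
Qed.

Lemma trig_poly_cst n c : trig_poly n (fun=> c).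
Proof.
exists (fun k => if k is 0 then c else 0), (fun=> 0) => x.
by rewrite big_nat_cond big1 ?addr0 // => -[|k] //; rewrite !mul0r addr0.
Qed.

Lemma trig_poly_sum n (I : Type) (s : seq I) (P : pred I) (t : I -> R -> R) :
  (forall i, trig_poly n (t i)) -> trig_poly n (fun x => \sum_(i <- s | P i) t i x).
Proof.
move=> ht; elim: s => [|i s IH].
  rewrite (_ : (fun x => _) = fun=> 0); first exact: trig_poly_cst.
  by apply: funext => x; rewrite big_nil.
case: (boolP (P i)) => Pi.
  rewrite (_ : (fun x => _) = fun x => t i x + \sum_(j <- s | P j) t j x).
    exact: trig_polyD.
  by apply: funext => x; rewrite big_cons Pi.
rewrite (_ : (fun x => _) = fun x => \sum_(j <- s | P j) t j x) //.
by apply: funext => x; rewrite big_cons (negbTE Pi).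
Qed.

Lemma trig_poly_harmonic n k c d : (k <= n)%N ->
  trig_poly n (fun x => c * cos (k%:R * x) + d * sin (k%:R * x)).
Proof.
case: k => [_|k kn].
  rewrite (_ : (fun x => _) = fun=> c); first exact: trig_poly_cst.
  by apply: funext => x; rewrite mul0r cos0 sin0 mulr1 mulr0 addr0.
exists (fun j => if j == k.+1 then c else 0), (fun j => if j == k.+1 then d else 0) => x.
rewrite add0r (bigD1_seq k.+1) ?mem_index_iota ?iota_uniq //= eqxx big1 ?addr0 //.
by move=> i /negbTE ->; rewrite !mul0r addr0.
Qed.

Lemma trig_poly_cos n k : (k <= n)%N -> trig_poly n (fun x : R => cos (k%:R * x)).
Proof.
move=> kn; have := @trig_poly_harmonic n k 1 0 kn; congr trig_poly.
by apply: funext => x; rewrite mul1r mul0r addr0.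
Qed.

Lemma trig_poly_sin n k : (k <= n)%N -> trig_poly n (fun x : R => sin (k%:R * x)).
Proof.
move=> kn; have := @trig_poly_harmonic n k 0 1 kn; congr trig_poly.
by apply: funext => x; rewrite mul1r mul0r add0r.
Qed.

(** Reduces a property stable under linear combinations to single harmonics. Constants enter as the
    cosine of frequency 0, so the sine case may assume [0 < k]. *)
Lemma trig_poly_ind n (P : (R -> R) -> Prop) :
  (forall t u, P t -> P u -> P (fun x => t x + u x)) ->
  (forall c t, P t -> P (fun x => c * t x)) ->
  (forall k, (k <= n)%N -> P (fun x => cos (k%:R * x))) ->
  (forall k, (0 < k <= n)%N -> P (fun x => sin (k%:R * x))) ->
  forall t, trig_poly n t -> P t.
Proof.
move=> PD PZ Pc Ps t [a [b et]].
have -> : t = fun x => a 0%N * cos (0%:R * x) +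
    \sum_(1 <= k < n.+1) (a k * cos (k%:R * x) + b k * sin (k%:R * x)).
  by apply: funext => x; rewrite et mul0r cos0 mulr1.
elim: n Pc Ps {et} => [|n IH] Pc Ps.
  rewrite (_ : (fun x => _) = fun x => a 0%N * cos (0%:R * x)); last first.
    by apply: funext => x; rewrite big_geq // addr0.
  by apply: PZ; exact: Pc.
rewrite (_ : (fun x => _) = fun x => (a 0%N * cos (0%:R * x) +
    \sum_(1 <= k < n.+1) (a k * cos (k%:R * x) + b k * sin (k%:R * x))) +
    (a n.+1 * cos (n.+1%:R * x) + b n.+1 * sin (n.+1%:R * x))); last first.
  by apply: funext => x; rewrite big_nat_recr //= addrA.
apply: (PD (fun x => _ + _)).
  apply: IH => k; first by move=> kn; apply: Pc; exact: leqW.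
  by move=> /andP[k0 kn]; apply: Ps; rewrite k0 leqW.
by apply: (PD (fun x => _ * _)); apply: PZ; [exact: Pc|apply: Ps; rewrite /=].
Qed.

Lemma trig_poly_widen m n t : (m <= n)%N -> trig_poly m t -> trig_poly n t.
Proof.
move=> mn; apply: trig_poly_ind.
- by move=> *; exact: trig_polyD.
- by move=> *; exact: trig_polyZ.
- by move=> k km; apply: trig_poly_cos; exact: leq_trans mn.
- by move=> k /andP[_ km]; apply: trig_poly_sin; exact: leq_trans mn.
Qed.

Lemma trig_poly_half_form n t : trig_poly n t -> half_form n.*2 t.
Proof.
have cs k : half_form k.*2 (fun x : R => cos (k%:R * x)) /\
            half_form k.*2 (fun x : R => sin (k%:R * x)).
  elim: k => [|k [hc hs]].
    by split; [exists 1|exists 0]; apply: funext => x; rewrite mul0r ?cos0 ?sin0.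
  have cx (x : R) : x = x / 2 + x / 2 by lra.
  have C u : half_form k.*2 u -> half_form k.+1.*2 (fun x => cos x * u x).
    move=> hu; rewrite (_ : (fun x => _) = fun x => cos (x / 2) * (cos (x / 2) * u x)
      + - 1 * (sin (x / 2) * (sin (x / 2) * u x))).
      apply: (@half_formD _ k.*2.+2).
        exact: half_formMcos (half_formMcos hu).
      exact: (@half_formZ _ k.*2.+2 _ _ (half_formMsin (half_formMsin hu))).
    by apply: funext => x; rewrite {1}(cx x) cosD; ring.
  have S u : half_form k.*2 u -> half_form k.+1.*2 (fun x => sin x * u x).
    move=> hu; rewrite (_ : (fun x => _) = fun x => 2 * (cos (x / 2) * (sin (x / 2) * u x))).
      exact: (@half_formZ _ k.*2.+2 _ _ (half_formMcos (half_formMsin hu))).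
    by apply: funext => x; rewrite {1}(cx x) sinD; ring.
  have e (x : R) : k.+1%:R * x = k%:R * x + x by rewrite -natr1 mulrDl mul1r.
  split.
    rewrite (_ : (fun x => _) = fun x => cos x * cos (k%:R * x) + -1 * (sin x * sin (k%:R * x))).
      by apply: half_formD; [exact: C|apply: half_formZ; exact: S].
    by apply: funext => x; rewrite e cosD; ring.
  rewrite (_ : (fun x => _) = fun x => cos x * sin (k%:R * x) + sin x * cos (k%:R * x)).
    by apply: half_formD; [exact: C|exact: S].
  by apply: funext => x; rewrite e sinD; ring.
have w k u : (k <= n)%N -> half_form k.*2 u -> half_form n.*2 u.
  by move=> kn /(@half_form_widen _ _ (n - k)); rewrite -doubleD subnKC.
apply: trig_poly_ind.
- by move=> *; exact: half_formD.
- by move=> *; exact: half_formZ.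
- by move=> k kn; apply: w kn _; exact: (cs k).1.
- by move=> k /andP[_ kn]; apply: w kn _; exact: (cs k).2.
Qed.

Lemma trig_polyMcos n t : trig_poly n t -> trig_poly n.+1 (fun x => cos x * t x).
Proof.
apply: (trig_poly_ind (P := fun t => trig_poly n.+1 (fun x => cos x * t x))).
- move=> u v hu hv; rewrite (_ : (fun x => _) = fun x => cos x * u x + cos x * v x).
    exact: trig_polyD.
  by apply: funext => x; rewrite mulrDr.
- move=> c u hu; rewrite (_ : (fun x => _) = fun x => c * (cos x * u x)).
    exact: trig_polyZ.
  by apply: funext => x; rewrite mulrCA.
- case=> [_|k kn].
    rewrite (_ : (fun x => _) = fun x => cos (1%:R * x)); first exact: trig_poly_cos.
    by apply: funext => x; rewrite mul0r cos0 mulr1 mul1r.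
  rewrite (_ : (fun x => _) = fun x => 1 / 2 * (cos (k.+2%:R * x) + cos (k%:R * x))).
    by apply: trig_polyZ; apply: trig_polyD; apply: trig_poly_cos; rewrite // ltnW // ltnW.
  apply: funext => x.
  have -> : k.+2%:R * x = k.+1%:R * x + x by rewrite -(natr1 k.+1) mulrDl mul1r.
  have -> : k%:R * x = k.+1%:R * x - x by rewrite -(natr1 k) mulrDl mul1r addrK.
  by rewrite cosD cosB; lra.
- case=> [//|k kn].
  rewrite (_ : (fun x => _) = fun x => 1 / 2 * (sin (k.+2%:R * x) + sin (k%:R * x))).
    by apply: trig_polyZ; apply: trig_polyD; apply: trig_poly_sin; rewrite // ltnW // ltnW.
  apply: funext => x.
  have -> : k.+2%:R * x = k.+1%:R * x + x by rewrite -(natr1 k.+1) mulrDl mul1r.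
  have -> : k%:R * x = k.+1%:R * x - x by rewrite -(natr1 k) mulrDl mul1r addrK.
  by rewrite sinD sinB; lra.
Qed.

Lemma trig_polyMsin n t : trig_poly n t -> trig_poly n.+1 (fun x => sin x * t x).
Proof.
apply: (trig_poly_ind (P := fun t => trig_poly n.+1 (fun x => sin x * t x))).
- move=> u v hu hv; rewrite (_ : (fun x => _) = fun x => sin x * u x + sin x * v x).
    exact: trig_polyD.
  by apply: funext => x; rewrite mulrDr.
- move=> c u hu; rewrite (_ : (fun x => _) = fun x => c * (sin x * u x)).
    exact: trig_polyZ.
  by apply: funext => x; rewrite mulrCA.
- case=> [_|k kn].
    rewrite (_ : (fun x => _) = fun x => sin (1%:R * x)); first exact: trig_poly_sin.
    by apply: funext => x; rewrite mul0r cos0 mulr1 mul1r.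
  rewrite (_ : (fun x => _) = fun x => 1 / 2 * (sin (k.+2%:R * x) + -1 * sin (k%:R * x))).
    apply: trig_polyZ; apply: trig_polyD; first exact: trig_poly_sin.
    by apply: trig_polyZ; apply: trig_poly_sin; rewrite // ltnW // ltnW.
  apply: funext => x.
  have -> : k.+2%:R * x = k.+1%:R * x + x by rewrite -(natr1 k.+1) mulrDl mul1r.
  have -> : k%:R * x = k.+1%:R * x - x by rewrite -(natr1 k) mulrDl mul1r addrK.
  by rewrite sinD sinB; lra.
- case=> [//|k kn].
  rewrite (_ : (fun x => _) = fun x => 1 / 2 * (cos (k%:R * x) + -1 * cos (k.+2%:R * x))).
    apply: trig_polyZ; apply: trig_polyD; last by apply: trig_polyZ; exact: trig_poly_cos.
    by apply: trig_poly_cos; rewrite // ltnW // ltnW.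
  apply: funext => x.
  have -> : k.+2%:R * x = k.+1%:R * x + x by rewrite -(natr1 k.+1) mulrDl mul1r.
  have -> : k%:R * x = k.+1%:R * x - x by rewrite -(natr1 k) mulrDl mul1r addrK.
  by rewrite cosB cosD; lra.
Qed.

(** Two half-angle factors make one full degree: their products are (1 + cos x) / 2, sin x / 2 and
    (1 - cos x) / 2. With the converse, products and translates of trigonometric polynomials come
    from those of forms. *)
Lemma half_form_trig_poly n t : half_form n.*2 t -> trig_poly n t.
Proof.
elim: n t => [|n IH] t; first by move=> [c ->]; exact: trig_poly_cst.
rewrite doubleS /= => -[u [v [[u1 [u2 [/IH h1 /IH h2 ->]]] [v1 [v2 [/IH h3 /IH h4 ->]]] ->]]].
rewrite (_ : (fun x => _) = fun x => 1 / 2 * (u1 x + cos x * u1 x + (sin x * u2 x + sin x * v1 x)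
  + (v2 x + -1 * (cos x * v2 x)))).
  have w u' : trig_poly n u' -> trig_poly n.+1 u' by apply: trig_poly_widen.
  apply: trig_polyZ; apply: trig_polyD.
    apply: trig_polyD; first by apply: trig_polyD; [exact: w|exact: trig_polyMcos].
    by apply: trig_polyD; exact: trig_polyMsin.
  by apply: trig_polyD; [exact: w|apply: trig_polyZ; exact: trig_polyMcos].
apply: funext => x.
have -> : cos x = cos (x / 2) ^+ 2 - sin (x / 2) ^+ 2.
  by rewrite !expr2 -cosD; congr cos; lra.
have -> : sin x = 2 * (sin (x / 2) * cos (x / 2)).
  have -> : sin x = sin (x / 2 + x / 2) by congr sin; lra.
  by rewrite sinD; ring.
have := cos2Dsin2 (x / 2); set c := cos _; set s := sin _ => e.
have -> : s ^+ 2 = 1 - c ^+ 2 by rewrite -e; ring.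
have -> : c * (c * u1 x + s * u2 x) + s * (c * v1 x + s * v2 x) =
  c ^+ 2 * u1 x + s * c * (u2 x + v1 x) + s ^+ 2 * v2 x by ring.
have -> : s ^+ 2 = 1 - c ^+ 2 by rewrite -e; ring.
by field.
Qed.

Lemma trig_polyM m n t u : trig_poly m t -> trig_poly n u ->
  trig_poly (m + n) (fun x => t x * u x).
Proof.
move=> /trig_poly_half_form ht /trig_poly_half_form hu; apply: half_form_trig_poly.
by rewrite doubleD; exact: half_formM.
Qed.

Lemma trig_polyX m n t : trig_poly n t -> trig_poly (n * m) (fun x => t x ^+ m).
Proof.
move=> ht; elim: m => [|m IH]; first exact: trig_poly_cst.
rewrite mulnS; have := trig_polyM ht IH; congr trig_poly.
by apply: funext => x; rewrite exprS.
Qed.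

Lemma trig_poly_shift n t a : trig_poly n t -> trig_poly n (fun x => t (x - a)).
Proof.
by move=> /trig_poly_half_form ht; apply: half_form_trig_poly; exact: half_form_shift.
Qed.

Lemma trig_poly_sin_half2 y : trig_poly 1 (fun x => sin ((x - y) / 2) ^+ 2).
Proof.
apply: half_form_trig_poly; have := half_formM (half_form_sin y) (half_form_sin y).
by congr half_form.
Qed.

Lemma trig_poly_periodic n t : trig_poly n t -> periodic2pi t.
Proof.
have e k x : k%:R * (x + 2 * pi) = k%:R * x + (pi *+ 2) *+ k.
  by rewrite mulrDr; congr (_ + _); rewrite !mulr_natl.
apply: trig_poly_ind.
- by move=> u v hu hv x; rewrite hu hv.
- by move=> c u hu x; rewrite hu.
- by move=> k _ x; rewrite e (periodicn (@cosD2pi R)).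
- by move=> k _ x; rewrite e (periodicn (@sinD2pi R)).
Qed.

Lemma trig_poly_bounded n t : trig_poly n t -> exists2 C : R, 0 <= C & forall x, `|t x| <= C.
Proof.
apply: (trig_poly_ind (P := fun t => exists2 C : R, 0 <= C & forall x, `|t x| <= C)).
- move=> u v [C C0 hC] [D D0 hD]; exists (C + D); first exact: addr_ge0.
  by move=> x; apply: (le_trans (ler_normD _ _)); exact: lerD.
- move=> c u [C C0 hC]; exists (`|c| * C); first exact: mulr_ge0.
  by move=> x; rewrite normrM ler_wpM2l.
- by move=> k _; exists 1 => // x; exact: cos_max.
- by move=> k _; exists 1 => // x; exact: sin_max.
Qed.

Lemma trig_poly_der n t : trig_poly n t -> exists2 t', trig_poly n t' & der t t'.
Proof.
apply: (trig_poly_ind (P := fun t => exists2 t', trig_poly n t' & der t t')).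
- move=> u v [u' hu du] [v' hv dv]; exists (fun x => u' x + v' x); first exact: trig_polyD.
  exact: derD.
- move=> c u [u' hu du]; exists (fun x => c * u' x); first exact: trig_polyZ.
  exact: derZ.
- move=> k kn; exists (fun x => - k%:R * sin (k%:R * x)).
    by apply: trig_polyZ; exact: trig_poly_sin.
  have := der_affine 0 k%:R (@der_cos R).
  by rewrite (_ : (fun x => _) = fun x => cos (k%:R * x)) => [|]; [apply: der_ext => x|apply: funext => x]; rewrite addr0 ?mulrN ?mulNr.
- move=> k /andP[_ kn]; exists (fun x => k%:R * cos (k%:R * x)).
    by apply: trig_polyZ; exact: trig_poly_cos.
  have := der_affine 0 k%:R (@der_sin R).
  by rewrite (_ : (fun x => _) = fun x => sin (k%:R * x)) => [|]; [apply: der_ext => x|apply: funext => x]; rewrite addr0.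
Qed.

(** The mean of [t] is what prevents a periodic antiderivative; it is carried along as the slope
    [c]. *)
Lemma trig_poly_antiderivative n t : trig_poly n t ->
  exists c, exists2 T, trig_poly n T & der (fun x => c * x + T x) t.
Proof.
pose P t := exists c, exists2 T, trig_poly n T & der (fun x => c * x + T x) t.
apply: (trig_poly_ind (P := P)).
- move=> u v [c [U hU dU]] [d [V hV dV]].
  exists (c + d), (fun x => U x + V x); first exact: trig_polyD.
  have := derD dU dV; rewrite (_ : (fun x => _) = fun x => (c + d) * x + (U x + V x)) //.
  by apply: funext => x; ring.
- move=> d u [c [U hU dU]]; exists (d * c), (fun x => d * U x); first exact: trig_polyZ.
  have := derZ d dU; rewrite (_ : (fun x => _) = fun x => (d * c) * x + d * U x) //.
  by apply: funext => x; ring.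
- case=> [_|k kn].
    exists 1, (fun=> 0); first exact: trig_poly_cst.
    have := @der_id R; rewrite (_ : (fun x => _) = fun x => 1 * x + 0).
      by apply: der_ext => x; rewrite mul0r cos0.
    by apply: funext => x; rewrite mul1r addr0.
  exists 0, (fun x => k.+1%:R^-1 * sin (k.+1%:R * x)).
    by apply: trig_polyZ; exact: trig_poly_sin.
  have := derZ k.+1%:R^-1 (der_affine 0 k.+1%:R (@der_sin R)).
  rewrite (_ : (fun x => _) = fun x => 0 * x + k.+1%:R^-1 * sin (k.+1%:R * x)); last first.
    by apply: funext => x; rewrite mul0r add0r addr0.
  by apply: der_ext => x; rewrite addr0 mulrA mulVf ?pnatr_eq0 // mul1r.
- case=> [//|k /andP[_ kn]].
  exists 0, (fun x => - k.+1%:R^-1 * cos (k.+1%:R * x)).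
    by apply: trig_polyZ; exact: trig_poly_cos.
  have := derZ (- k.+1%:R^-1) (der_affine 0 k.+1%:R (@der_cos R)).
  rewrite (_ : (fun x => _) = fun x => 0 * x + - k.+1%:R^-1 * cos (k.+1%:R * x)); last first.
    by apply: funext => x; rewrite mul0r add0r addr0.
  by apply: der_ext => x; rewrite addr0 mulrA mulNr mulVf ?pnatr_eq0 // mulN1r opprK.
Qed.

Lemma trig_poly_continuous n t : trig_poly n t -> continuous t.
Proof. by move=> /trig_poly_der[t' _ dt]; exact: der_continuous dt. Qed.

Lemma trig_poly_lipschitz n t : trig_poly n t ->
  exists2 C : R, 0 <= C & forall x y, `|t x - t y| <= C * `|x - y|.
Proof.
move=> /trig_poly_der[t' /trig_poly_bounded[C C0 hC] dt]; exists C => // x y.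
by apply: der_lip dt _ => z _; exact: hC.
Qed.

(** Lipschitz bound in the periodic distance, the quantity from which [omega] is built. *)
Lemma trig_poly_lipschitz_sin n t : trig_poly n t ->
  exists2 C : R, 0 <= C & forall x a, `|t x - t a| <= C * `|sin ((x - a) / 2)|.
Proof.
move=> ht; have [C C0 hC] := trig_poly_lipschitz ht.
exists (C * 8); first by rewrite mulr_ge0.
move=> x a; have [z hz] := near_mod_2pi a x.
rewrite -(periodic2piz x z (trig_poly_periodic ht)) -(norm_sin_half_shift x a z).
apply: (le_trans (hC _ _)); rewrite -[C * 8 * _]mulrA; apply: ler_wpM2l => //.
exact: norm_le_sin_half.
Qed.

End TrigPolynomials.

(* Comparable to the square of [1 + N d], where [d] is the distance of [x] to the multiples of [2 pi]. *)
Definition omega {R : realType} (N : nat) (x : R) : R := 1 + N%:R ^+ 2 * sin (x / 2) ^+ 2.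

Definition node {R : realType} (M j : nat) : R := 2 * pi * j%:R / M%:R.

(** * Powers of the Fejer kernel and sums of [omega] over the nodes *)

Section Kernel.
Variable R : realType.
Implicit Types (t u v : R -> R) (a b c x y : R) (N M n m k : nat).

Lemma omega_ge1 N x : 1 <= omega N x.
Proof. by rewrite lerDl mulr_ge0 // ?exprn_even_ge0. Qed.

Lemma omega_gt0 N x : 0 < omega N x.
Proof. exact: lt_le_trans ltr01 (omega_ge1 N x). Qed.

Lemma omegaE N x : omega N x = 1 + (N%:R * `|sin (x / 2)|) ^+ 2.
Proof. by rewrite exprMn real_normK ?num_real. Qed.

Lemma omega_sub N x y : omega N (x - y) = omega N (y - x).
Proof. by rewrite !omegaE -opprB mulNr sinN normrN. Qed.

Lemma le_omega N x : N%:R * `|sin (x / 2)| <= omega N x.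
Proof.
rewrite omegaE; set z := _ * _; have : 0 <= (z - 1 / 2) ^+ 2 by exact: exprn_even_ge0.
by rewrite sqrrB; lra.
Qed.

Lemma sqr_le_omega N x : (1 + N%:R * `|sin (x / 2)|) ^+ 2 <= 2 * omega N x.
Proof.
rewrite omegaE; set z := _ * _; have : 0 <= (z - 1) ^+ 2 by exact: exprn_even_ge0.
by rewrite !expr2; lra.
Qed.

Lemma trig_poly_omega N a : trig_poly 1 (fun x => omega N (x - a)).
Proof.
by apply: trig_polyD; [exact: trig_poly_cst|apply: trig_polyZ; exact: trig_poly_sin_half2].
Qed.

Lemma omega_shift N x a (z : int) : omega N (x + 2 * pi * z%:~R - a) = omega N (x - a).
Proof. by rewrite !omegaE norm_sin_half_shift. Qed.

(** Telescopes, since 2 sin (b / 2) cos t = sin (t + b / 2) - sin (t - b / 2). *)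
Lemma sum_cos_arith a b n : 2 * sin (b / 2) * \sum_(j < n) cos (a - j%:R * b) =
  sin (a + b / 2) - sin (a + b / 2 - n%:R * b).
Proof.
elim: n => [|n IH]; first by rewrite big_ord0 mulr0 mul0r subr0 subrr.
rewrite big_ord_recr /= mulrDr IH.
have -> : n.+1%:R * b = n%:R * b + b by rewrite -(natr1 n) mulrDl mul1r.
set d := a - n%:R * b.
have -> : a + b / 2 - n%:R * b = d + b / 2 by rewrite /d; ring.
have -> : a + b / 2 - (n%:R * b + b) = d - b / 2 by rewrite /d; lra.
by rewrite (sinB d) (sinD d); ring.
Qed.

(** The M steps add up to k full turns, so the telescoped sum vanishes; [0 < k < M] keeps sin (b /
    2) nonzero. *)
Lemma sum_cos_nodes k M a : (0 < k < M)%N ->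
  \sum_(j < M) cos (a - j%:R * (2 * pi * k%:R / M%:R)) = 0.
Proof.
move=> /andP[k0 kM]; set b := 2 * pi * k%:R / M%:R.
have p0 : 0 < pi :> R := pi_gt0 R.
have M0 : 0 < M%:R :> R by rewrite ltr0n (leq_trans _ kM).
have hb : b / 2 = pi * (k%:R / M%:R) by rewrite /b; lra.
have sb : 0 < sin (b / 2).
  have k0' : 0 < k%:R :> R by rewrite ltr0n.
  apply: sin_gt0_pi; rewrite hb pmulr_rgt0 // divr_gt0 //=.
  by rewrite gtr_pMr // ltr_pdivrMr // mul1r ltr_nat.
have := sum_cos_arith a b M.
have -> : a + b / 2 - M%:R * b = a + b / 2 + 2 * pi * (- k%:Z)%:~R.
  rewrite mulrNz mulrN /b [M%:R * _]mulrC divfK //; by rewrite gt_eqF.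
rewrite (@periodic2piz R (@sin R)) ?subrr; last first.
  by move=> x; rewrite mulr_natl sinD2pi.
have sb' : 0 < 2 * sin (b / 2) by lra.
by move=> /eqP; rewrite mulf_eq0 (gt_eqF sb') /= => /eqP.
Qed.

(** The squared modulus of the sum of e^(ikx) over k < N, that is, N times the Fejer kernel. *)
Definition fejer N x := (\sum_(k < N) cos (k%:R * x)) ^+ 2 + (\sum_(k < N) sin (k%:R * x)) ^+ 2.

Lemma fejer_ge0 N x : 0 <= fejer N x.
Proof. by rewrite addr_ge0 // exprn_even_ge0. Qed.

Lemma trig_poly_fejer N : trig_poly (N * 2) (fejer N).
Proof.
apply: trig_polyD; apply: trig_polyX; apply: trig_poly_sum => i.
  by apply: trig_poly_cos; exact: ltnW.
by apply: trig_poly_sin; exact: ltnW.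
Qed.

Lemma norm_sum_le1 N (F : nat -> R) : (forall k, `|F k| <= 1) -> (\sum_(k < N) F k) ^+ 2 <= N%:R ^+ 2.
Proof.
move=> hF; rewrite -(real_normK (num_real (\sum_(k < N) F k))) lerXn2r ?nnegrE //.
apply: (le_trans (ler_norm_sum _ _ _)); apply: (@le_trans _ _ (\sum_(k < N) 1)); first by apply: ler_sum => k _; exact: hF.
by rewrite sumr_const card_ord.
Qed.

(** Combines the trivial bound 2 N^2 with [fejer * sin^2 <= 1], the latter multiplied by N^2. *)
Lemma fejer_omega_le N x : fejer N x * omega N x <= 3 * N%:R ^+ 2.
Proof.
have h1 : fejer N x <= 2 * N%:R ^+ 2.
  rewrite mulr_natl mulr2n lerD //.
    by apply: (norm_sum_le1 _ (F := fun k => cos (k%:R * x))) => k; exact: cos_max.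
  by apply: (norm_sum_le1 _ (F := fun k => sin (k%:R * x))) => k; exact: sin_max.
have h2 : fejer N x * sin (x / 2) ^+ 2 <= 1.
  (* The phases 0 and pi / 2 give the cosine and the sine sum. The two right-hand sides are the
     coordinates of a chord of the unit circle, so their squares add up to at most 4. *)
  have := sum_cos_arith 0 x N; have := sum_cos_arith (pi / 2) x N.
  rewrite (eq_bigr (fun k : 'I_N => sin (k%:R * x))) => [|k _]; last first.
    by rewrite -opprB cosN cosBpihalf.
  rewrite [in X in _ -> X](eq_bigr (fun k : 'I_N => cos (k%:R * x))) => [|k _]; last first.
    by rewrite sub0r cosN.
  rewrite add0r -addrA (addrC (pi / 2)) sinDpihalf (addrC (pi / 2)) sinDpihalf /fejer.
  set S := \sum_(k < N) sin _; set C := \sum_(k < N) cos _ => eS eC.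
  have e : 4 * ((C ^+ 2 + S ^+ 2) * sin (x / 2) ^+ 2) =
      (2 * sin (x / 2) * C) ^+ 2 + (2 * sin (x / 2) * S) ^+ 2 by ring.
  have := cos2Dsin2 (x / 2); have := cos2Dsin2 (x / 2 - N%:R * x).
  have := cos_geN1 (x / 2 - (x / 2 - N%:R * x)); rewrite (cosB (x / 2)).
  move: e; rewrite eS eC.
  set s := sin (x / 2); set c := cos (x / 2); set s' := sin _; set c' := cos _.
  by rewrite !expr2; nra.
by rewrite /omega mulrDr mulr1; have := ler0n R N; nra.
Qed.

(** All angles k x lie in [-1, 1], where the cosine is at least 1/2. *)
Lemma fejer_ge N x : `|x| * N%:R <= 1 -> N%:R ^+ 2 / 4 <= fejer N x.
Proof.
move=> hx.
have h : N%:R / 2 <= \sum_(k < N) cos (k%:R * x).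
  rewrite -[leLHS](_ : \sum_(k < N) (1 / 2 : R) = _); last first.
    by rewrite sumr_const card_ord -[_ *+ N]mulr_natl; lra.
  apply: ler_sum => k _; apply: le_trans (cos_ge_quadratic _).
  have kx : `|k%:R * x| <= 1.
    rewrite normrM normr_nat mulrC; apply: le_trans hx.
    by rewrite ler_wpM2l // ler_nat ltnW.
  have : `|k%:R * x| ^+ 2 <= 1 by rewrite exprn_ile1.
  by rewrite real_normK ?num_real //; lra.
have : (N%:R / 2) ^+ 2 <= (\sum_(k < N) cos (k%:R * x)) ^+ 2.
  by rewrite lerXn2r // nnegrE ?divr_ge0 // (le_trans _ h) // divr_ge0.
have : 0 <= (\sum_(k < N) sin (k%:R * x)) ^+ 2 by exact: exprn_even_ge0.
by rewrite /fejer expr_div_n; lra.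
Qed.

Lemma fejer0 N : fejer N 0 = N%:R ^+ 2.
Proof.
rewrite /fejer; under eq_bigr do rewrite mulr0 cos0.
under [in X in _ + X ^+ 2]eq_bigr do rewrite mulr0 sin0.
by rewrite sumr_const card_ord sumr_const mul0rn expr0n addr0.
Qed.

(** Integral test with the arctangent: over a unit step 1 / (1 + t^2) changes by a factor of at most
    3, and the range of [atan] has length pi < 4. *)
Lemma sum_inv_sqr_le M x : \sum_(j < M) (1 + (x - j%:R) ^+ 2)^-1 <= 12.
Proof.
have key n : \sum_(j < n) (1 + (x - j%:R) ^+ 2)^-1 <= 3 * (atan (n%:R - x) - atan (- x)).
  elim: n => [|n IH]; first by rewrite big_ord0 sub0r subrr mulr0.
  rewrite big_ord_recr /= -(natr1 n).
  have h : n%:R - x <= n%:R + 1 - x by lra.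
  have [c /andP[c1 c2] e] := der_MVT (@der_atan R) h.
  have : (1 + (x - n%:R) ^+ 2)^-1 <= 3 * (1 + c ^+ 2)^-1.
    have p1 : 0 < 1 + (x - n%:R) ^+ 2 by rewrite ltr_wpDr // exprn_even_ge0.
    have p2 : 0 < 1 + c ^+ 2 by rewrite ltr_wpDr // exprn_even_ge0.
    rewrite -[leLHS]mul1r ler_pdivrMr // mulrAC ler_pdivlMr // mul1r.
    have h1 : 0 <= (c - (n%:R - x) - (n%:R - x)) ^+ 2 by exact: exprn_even_ge0.
    have h2 : (c - (n%:R - x)) ^+ 2 <= 1 by rewrite expr_le1 //; lra.
    have h3 : 0 <= (x - n%:R) ^+ 2 by exact: exprn_even_ge0.
    by move: h1 h2 h3; rewrite !expr2; lra.
  move: e; have -> : n%:R + 1 - x - (n%:R - x) = 1 by lra.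
  by rewrite mulr1; lra.
apply: (le_trans (key M)); have := atan_ltpi2 (M%:R - x); have := atan_gtNpi2 (- x).
by have := pihalf_lt2 R; lra.
Qed.

(** At most [m * N] equidistant nodes have spacing at least of order 1/N, so N times the distance to
    a node is comparable, from below, to the distance between indices, and the sum is compared with
    that of 1 / (1 + v^2). *)
Lemma sum_inv_omega_le m : exists2 C : R, 0 <= C & forall N M x,
  (0 < N)%N -> (0 < M)%N -> (M <= m * N)%N -> \sum_(j < M) (omega N (x - node M j))^-1 <= C.
Proof.
exists ((m.+1%:R * 4) ^+ 2 * (12 * 3)); first by rewrite mulr_ge0 // exprn_even_ge0.
move=> N M x N0 M0 MN.
have p0 : 0 < pi :> R := pi_gt0 R.
have p1 : 1 <= pi / 2 :> R := pihalf_ge1 R.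
have M0' : 0 < M%:R :> R by rewrite ltr0n.
have pM : 0 < 2 * pi / M%:R :> R by rewrite divr_gt0 // mulr_gt0.
wlog /andP[x0 x2] : x / 0 <= x <= 2 * pi => [hw|].
  have [z hz] := near_mod_2pi pi x.
  rewrite (eq_bigr (fun j : 'I_M => (omega N (x + 2 * pi * z%:~R - node M j))^-1)); last first.
    by move=> j _; rewrite omega_shift.
  by apply: hw; move: hz; rewrite ler_norml; lra.
set s := x / (2 * pi / M%:R).
have xE : x = 2 * pi / M%:R * s by rewrite mulrC divfK // gt_eqF.
pose A := (m.+1%:R * 4 : R) ^+ 2.
have A0 : 0 < A by rewrite exprn_gt0 // mulr_gt0.
pose B z (j : nat) : R := (1 + (s + z - j%:R) ^+ 2)^-1.
have B0 z j : 0 <= B z j by rewrite invr_ge0 addr_ge0 // exprn_even_ge0.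
(* [z] is the number of turns that brings [x] within pi of the node. Only 0, 1 and -1 occur, and
   each contributes one sum bounded by 12. *)
have key (z : int) (j : nat) : `|x + 2 * pi * z%:~R - node M j| <= pi ->
    (omega N (x - node M j))^-1 <= A * B (M%:R * z%:~R) j.
  move=> hz; rewrite -(omega_shift _ _ _ z).
  set v := s + M%:R * z%:~R - j%:R.
  have ev : x + 2 * pi * z%:~R - node M j = 2 * pi / M%:R * v.
    rewrite /v /node xE; move: (pi) M%:R M0' => p MM MM0; field; by rewrite gt_eqF.
  have v1 : 0 < 1 + v ^+ 2 by rewrite ltr_wpDr // exprn_even_ge0.
  rewrite -[leLHS]mul1r ler_pdivrMr ?omega_gt0 // /B -/v mulrAC ler_pdivlMr // mul1r.
  have hs := norm_le_sin_half hz; rewrite omegaE; set S := `|sin _| in hs *.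
  have NM : M%:R <= m.+1%:R * N%:R :> R.
    by rewrite -natrM ler_nat (leq_trans MN) // leq_mul2r leqnSn orbT.
  have hv : `|v| <= m.+1%:R * 4 * (N%:R * S).
    move: hs; rewrite ev normrM (gtr0_norm pM) => hs.
    have e : `|v| = M%:R * (2 * pi / M%:R * `|v|) / (2 * pi).
      by move: (pi) p0 M%:R M0' => p p0' MM MM0; field; rewrite !gt_eqF.
    rewrite e ler_pdivrMr ?mulr_gt0 //.
    apply: (le_trans (ler_wpM2l (ltW M0') hs)).
    have S0 : 0 <= S by exact: normr_ge0.
    apply: (le_trans (ler_wpM2r _ NM)); first by rewrite mulr_ge0.
    have : 0 <= m.+1%:R * N%:R * S * (pi - 1) by rewrite !mulr_ge0 //; lra.
    by lra.
  have : `|v| ^+ 2 <= (m.+1%:R * 4 * (N%:R * S)) ^+ 2.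
    by rewrite lerXn2r ?nnegrE // !mulr_ge0 // normr_ge0.
  rewrite real_normK ?num_real // exprMn -/A mulrDr mulr1.
  have : 1 <= A by rewrite exprn_ege1 // -[leLHS]mulr1 ler_pM // ler1n.
  by lra.
have hj (j : 'I_M) : (omega N (x - node M j))^-1 <=
    A * (B (M%:R * 0) j + B (M%:R * 1) j + B (M%:R * -1) j).
  have j0 : 0 <= node M j :> R by rewrite /node !(mulr_ge0, invr_ge0) // ltW.
  have j2 : node M j <= 2 * pi :> R.
    rewrite /node ler_pdivrMr // ler_wpM2l ?ler_nat; first by [].
      by rewrite mulr_ge0 // ltW.
    exact: ltnW.
  have a1 := B0 (M%:R * 0) j; have a2 := B0 (M%:R * 1) j; have a3 := B0 (M%:R * -1) j.
  case: (lerP `|x - node M j| pi) => h0.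
    have := key 0 j; rewrite mulr0z mulr0 addr0 => /(_ h0).
    by rewrite mulr0; nra.
  move: h0; rewrite ltr_normr => /orP[h0|h0].
    have := key (-1) j; rewrite mulrN1z mulrN1 ler_norml.
    by move=> /(_ ltac:(lra)); nra.
  have := key 1 j; rewrite mulr1z mulr1 ler_norml.
  by move=> /(_ ltac:(lra)); nra.
apply: (@le_trans _ _ (\sum_(j < M) A * (B (M%:R * 0) j + B (M%:R * 1) j + B (M%:R * -1) j))).
  by apply: ler_sum => j _; exact: hj.
rewrite -mulr_sumr ler_wpM2l ?(ltW A0) // !big_split /=.
have S z : \sum_(j < M) B z j <= 12 by exact: sum_inv_sqr_le.
have := S (M%:R * 0); have := S (M%:R * 1); have := S (M%:R * -1).
by lra.
Qed.

(* The mesh has more nodes than the order of the kernel, so summing the translates of a power of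
   the Fejer kernel leaves only its mean. *)
Lemma kernel_partition m : (0 < m)%N -> exists C c : R, [/\ 0 <= C, 0 < c &
  forall N, (0 < N)%N -> exists M (phi : R -> R), [/\ (0 < M)%N,
    trig_poly (N * 2 * m) phi,
    (forall x, 0 <= phi x) &
    [/\ forall x, \sum_(j < M) phi (x - node M j) = 1,
    forall x, phi x <= C * (omega N x) ^- m,
    forall x, `|x| * N%:R <= 1 -> c <= phi x &
    forall x, \sum_(j < M) (omega N (x - node M j))^-1 <= C]]].
Proof.
move=> m0; have [C C0 hC] := sum_inv_omega_le (m * 3).
(* With Q = N^2 the normalising constant [A] lies between Q^m and 3^m Q^m (C + 1). The first bound
   gives the upper estimate of the kernel, the second its lower estimate near 0. *)
exists (3 ^+ m + C), ((1 / 4) ^+ m / (3 ^+ m * (C + 1))).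
have C1 : 0 < C + 1 by lra.
have t0 : 0 < 3 ^+ m :> R by rewrite exprn_gt0.
split; first by rewrite addr_ge0 // ltW.
  by rewrite divr_gt0 ?mulr_gt0 // exprn_gt0.
move=> N N0; pose K := (N * 2 * m)%N; pose M := K.+1.
pose J x := fejer N x ^+ m.
have hJ : trig_poly K J by apply: trig_polyX; exact: trig_poly_fejer.
have J0 x : 0 <= J x by rewrite exprn_ge0 // fejer_ge0.
have [a [b eJ]] := hJ.
pose A := M%:R * a 0%N.
have sumJ x : \sum_(j < M) J (x - node M j) = A.
  under eq_bigr do rewrite eJ.
  rewrite big_split /= sumr_const card_ord -mulr_natl -/A exchange_big /=.
  rewrite big_nat_cond big1 ?addr0 // => k /andP[/andP[k1 kM] _].
  rewrite big_split /= -!mulr_sumr.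
  have e (j : 'I_M) : k%:R * (x - node M j) = k%:R * x - j%:R * (2 * pi * k%:R / M%:R).
    by rewrite /node; ring.
  under eq_bigr do rewrite e.
  rewrite sum_cos_nodes ?k1 // mulr0 add0r.
  rewrite (eq_bigr (fun j : 'I_M => cos (k%:R * x - pi / 2 - j%:R * (2 * pi * k%:R / M%:R)))).
    by rewrite sum_cos_nodes ?k1 // mulr0.
  by move=> j _; rewrite e addrAC cosBpihalf.
have N0' : 0 < N%:R :> R by rewrite ltr0n.
pose Q := N%:R ^+ 2 : R; have Q0 : 0 < Q by rewrite exprn_gt0.
have JQ x : J x <= 3 ^+ m * Q ^+ m * (omega N x) ^- m.
  rewrite ler_pdivlMr ?exprn_gt0 ?omega_gt0 // /J -!exprMn.
  by rewrite lerXn2r ?nnegrE ?mulr_ge0 ?fejer_ge0 ?(ltW (omega_gt0 _ _)) ?(ltW Q0) ?fejer_omega_le.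
have AQ : Q ^+ m <= A.
  rewrite -(sumJ 0) (bigD1 ord0) //= /node mulr0 mul0r subr0 {1}/J fejer0 lerDl.
  by apply: sumr_ge0.
have A0 : 0 < A by apply: lt_le_trans AQ; rewrite exprn_gt0.
have MN : (M <= m * 3 * N)%N.
  rewrite /M /K -mulnA (mulnC N) -addn1.
  rewrite (_ : m * 3 * N = 2 * m * N + m * N)%N; last by rewrite -mulnDl (mulnC m) -mulSnr.
  by rewrite leq_add2l muln_gt0 m0.
have QA : A <= 3 ^+ m * Q ^+ m * (C + 1).
  rewrite -(sumJ 0).
  apply: (@le_trans _ _ (\sum_(j < M) 3 ^+ m * Q ^+ m * (omega N (0 - node M j)) ^- m)).
    by apply: ler_sum => j _; exact: JQ.
  rewrite -mulr_sumr ler_wpM2l ?mulr_ge0 ?exprn_ge0 // ?(ltW Q0) //.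
  apply: (@le_trans _ _ C); last by lra.
  apply: le_trans (hC N M 0 N0 isT MN); apply: ler_sum => j _.
  rewrite lef_pV2 ?posrE ?exprn_gt0 ?omega_gt0 //.
  by rewrite ler_eXnr // omega_ge1.
exists M, (fun x => A^-1 * J x); split => //.
- exact: trig_polyZ.
- by move=> x; rewrite mulr_ge0 // invr_ge0 ltW.
split.
- by move=> x; rewrite -mulr_sumr sumJ mulVf // gt_eqF.
- move=> x; rewrite mulrC ler_pdivrMr //; apply: (le_trans (JQ x)).
  rewrite mulrAC ler_pM ?mulr_ge0 ?exprn_ge0 ?invr_ge0 ?exprn_ge0 ?(ltW (omega_gt0 _ _)) ?(ltW Q0) //.
  by rewrite ler_wpM2r ?invr_ge0 ?exprn_ge0 ?(ltW (omega_gt0 _ _)) // lerDl.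
- move=> x hx; rewrite [leRHS]mulrC ler_pdivlMr //.
  have hF : (Q / 4) ^+ m <= J x.
    by rewrite lerXn2r ?nnegrE ?fejer_ge0 ?fejer_ge // divr_ge0 // ltW.
  apply: le_trans hF; rewrite mulrAC ler_pdivrMr ?mulr_gt0 //.
  apply: (le_trans (ler_wpM2l _ QA)); first by rewrite exprn_ge0 // divr_ge0.
  by rewrite !exprMn expr1n; lra.
- by move=> x; apply: (le_trans (hC N M x N0 isT MN)); rewrite lerDr ltW.
Qed.

End Kernel.

(** * Local approximation of smooth periodic functions by polynomials of bounded order *)

Section LocalApproximation.
Variable R : realType.
Implicit Types (f g G t u v : R -> R) (a b c x y L : R) (N M n m k : nat).

(** Stands in for W^(k+1), see [W_lipschitz_class], and frees the approximation argument from
    almost-everywhere derivatives. The recursion matches inductions that pass to the derivative. *)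
Fixpoint lipschitz_class k L g : Prop :=
  periodic2pi g /\
  if k is k'.+1 then exists2 g', der g g' & lipschitz_class k' L g'
  else forall x y, `|g x - g y| <= L * `|x - y|.

Lemma lipschitz_class_periodic k L g : lipschitz_class k L g -> periodic2pi g.
Proof. by case: k => [|k] []. Qed.

Lemma lipschitz_continuous L g : (forall x y, `|g x - g y| <= L * `|x - y|) -> continuous g.
Proof.
move=> hL x; apply/cvgrPdist_le => e e0.
have L1 : 0 < `|L| + 1 by rewrite ltr_wpDl.
near=> z; apply: (le_trans (hL _ _)).
apply: (@le_trans _ _ ((`|L| + 1) * `|x - z|)).
  by rewrite ler_wpM2r // ler_wpDr // ler_norm.
rewrite mulrC -ler_pdivlMr //.
apply: ltW; near: z; apply: (@nbhsx_ballx R R^o x); exact: divr_gt0.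
Unshelve. all: by end_near.
Qed.

Lemma lipschitz_class_continuous k L g : lipschitz_class k L g -> continuous g.
Proof.
case: k => [|k] [_]; first exact: lipschitz_continuous.
by move=> [g' dg _]; exact: der_continuous dg.
Qed.

(** The derivative is nonnegative and not identically 0, so its mean [c] is positive, although it is
    flat at 0: a multiple of it can cancel any mean while staying small near the centre. *)
Lemma trig_poly_flat k : exists c, exists2 V, 0 < c /\ trig_poly k V &
  der (fun x => c * x + V x) (fun x : R => (sin (x / 2) ^+ 2) ^+ k).
Proof.
have hv : trig_poly k (fun x : R => (sin (x / 2) ^+ 2) ^+ k).
  have := trig_polyX k (trig_poly_sin_half2 (0 : R)); rewrite mul1n; congr trig_poly.
  by apply: funext => x; rewrite subr0.
have [c [V hV dV]] := trig_poly_antiderivative hv.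
exists c, V => //; split => //.
have p0 : 0 < pi :> R := pi_gt0 R.
have vge0 (x : R) : 0 <= (sin (x / 2) ^+ 2) ^+ k by rewrite exprn_ge0 // exprn_even_ge0.
have ppi : 0 < (pi : R) < 2 * pi by rewrite p0; lra.
have := der_lt dV vge0 ppi _; rewrite sin_pihalf !expr1n => /(_ ltr01).
rewrite -[2 * pi]add0r (trig_poly_periodic hV) add0r mulr0 add0r ltrDr.
by rewrite pmulr_lgt0 // mulr_gt0.
Qed.

Lemma sin_flat_le k x : (sin (x / 2) ^+ 2) ^+ k <= `|x| ^+ k.
Proof.
rewrite lerXn2r ?nnegrE ?exprn_even_ge0 //.
rewrite -real_normK ?num_real //.
have h := norm_sin_le (x / 2); have h1 := sin_max (x / 2).
move: h; rewrite normrM (@ger0_norm _ 2^-1) ?invr_ge0 // => h.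
have s0 := normr_ge0 (sin (x / 2)); have x0 := normr_ge0 x.
by rewrite expr2; nra.
Qed.

(* Induction on [k]: integrate an approximation of the derivative, after moving its mean
   onto a trigonometric polynomial that is flat at [a]. *)
Lemma local_approx k L : 0 <= L -> exists D (C : R), 0 <= C /\
  forall g, lipschitz_class k L g -> forall a, exists G, [/\ trig_poly D G, G a = g a &
    forall x y, `|(g x - G x) - (g y - G y)| <=
      C * `|x - y| * Num.max `|x - a| `|y - a| ^+ k].
Proof.
move=> L0; elim: k => [|k [D [C [C0 IH]]]].
  exists 0%N, L; split => // g [_ hg] a; exists (fun=> g a); split => //.
    exact: trig_poly_cst.
  by move=> x y; rewrite expr0 mulr1 opprB addrA subrK; exact: hg.
have [c [V [c0 hV] dV]] := trig_poly_flat k.+1.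
pose C' := C + C * (2 * pi) ^+ k.+1 / c.
have p0 : 0 < pi :> R := pi_gt0 R.
have p2 : 0 <= 2 * pi :> R by rewrite mulr_ge0 // ltW.
exists (maxn D k.+1), C'; split.
  by rewrite addr_ge0 // divr_ge0 ?mulr_ge0 ?exprn_ge0 // ltW.
move=> g [pg [g' dg hg']] a.
have [H [tH Ha hH]] := IH g' hg' a.
have [mu [T hT dT]] := trig_poly_antiderivative tH.
have hgH x : `|g' x - H x| <= C * `|x - a| ^+ k.+1.
  have := hH x a; rewrite Ha !subrr normr0 subr0 => h; apply: (le_trans h).
  by rewrite (max_idPl (normr_ge0 (x - a))) -mulrA -exprS.
(* By periodicity of [g], its derivative has mean 0, so [mu] is, up to sign, the mean of the
   approximation error. *)
have hmu : `|mu| <= C * (2 * pi) ^+ k.+1.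
  have dd := derB dg dT.
  have := @der_lip _ _ _ a (a + 2 * pi) (C * (2 * pi) ^+ k.+1) dd.
  rewrite pg (trig_poly_periodic hT).
  have -> : g a - (mu * (a + 2 * pi) + T a) - (g a - (mu * a + T a)) = - mu * (2 * pi) by ring.
  rewrite normrM normrN (addrC a) addrK ler_pM2r ?normr_gt0; last by rewrite gt_eqF // mulr_gt0.
  have aa : a <= 2 * pi + a by rewrite lerDr.
  apply=> x; rewrite (min_idPl aa) (max_idPr aa) => /andP[xa xb].
  apply: (le_trans (hgH x)); rewrite ler_wpM2l // lerXn2r ?nnegrE //.
  by rewrite ger0_norm; lra.
pose G0 x := T x - mu / c * V (x - a).
have dG : der (fun x => g x - G0 x) (fun x => g' x - H x + mu / c * (sin ((x - a) / 2) ^+ 2) ^+ k.+1).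
  have d1 := der_affine (- a) 1 dV.
  have := derD (derB dg dT) (derZ (mu / c) d1).
  have c0' : c != 0 by rewrite gt_eqF.
  have d2 := der_cst (mu * a).
  move=> /derD/(_ d2).
  rewrite (_ : (fun x => _ + mu * a) = fun x => g x - G0 x); last first.
    by apply: funext => x; rewrite /G0 mul1r; field.
  by apply: der_ext => x; rewrite addr0 !mul1r.
have tG0 : trig_poly (maxn D k.+1) G0.
  apply: trig_polyD; first by apply: trig_poly_widen hT; exact: leq_maxl.
  rewrite (_ : (fun x => _) = fun x => - (mu / c) * V (x - a)).
    apply: trig_polyZ; apply: trig_poly_shift; apply: trig_poly_widen hV; exact: leq_maxr.
  by apply: funext => x; rewrite mulNr.
exists (fun x => G0 x + (g a - G0 a)); split.
- by apply: trig_polyD => //; exact: trig_poly_cst.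
- by rewrite addrC subrK.
move=> x y.
have -> : g x - (G0 x + (g a - G0 a)) - (g y - (G0 y + (g a - G0 a))) =
  g x - G0 x - (g y - G0 y) by ring.
set mx := Num.max _ _; rewrite mulrAC.
apply: (der_lip dG) => z hz.
have zm : `|z - a| <= mx.
  rewrite /mx; move: hz; case: (leP y x) => yx /andP[zx zy];
  rewrite le_max; apply/orP; case: (leP a z) => az.
  - by left; rewrite !ger0_norm; lra.
  - by right; rewrite !ler0_norm; lra.
  - by right; rewrite !ger0_norm; lra.
  - by left; rewrite !ler0_norm; lra.
apply: (@le_trans _ _ (C' * `|z - a| ^+ k.+1)); last first.
  rewrite ler_wpM2l ?lerXn2r ?nnegrE //; last by rewrite (le_trans _ zm).
  by rewrite addr_ge0 // divr_ge0 ?mulr_ge0 ?exprn_ge0 // ltW.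
apply: (le_trans (ler_normD _ _)).
rewrite [leRHS](_ : _ = C * `|z - a| ^+ k.+1 + C * (2 * pi) ^+ k.+1 / c * `|z - a| ^+ k.+1).
  apply: lerD; first exact: hgH.
  rewrite normrM ler_pM //.
    by rewrite normrM normfV (gtr0_norm c0) ler_wpM2r // invr_ge0 ltW.
  have v0 : 0 <= (sin ((z - a) / 2) ^+ 2) ^+ k.+1.
    by apply: exprn_ge0; exact: exprn_even_ge0.
  by rewrite [leLHS]ger0_norm // sin_flat_le.
by rewrite /C' [LHS]mulrDl.
Qed.

End LocalApproximation.

(** * Growth of a polynomial of bounded order from its weighted integral; integrals of 1 /
    [omega] *)

Section Growth.
Variable R : realType.
Implicit Types (p phi U W u : R -> R) (a b x y : R) (N D k m : nat).

Lemma der_period U u a : der U u -> periodic2pi u -> U (a + 2 * pi) - U a = U (2 * pi) - U 0.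
Proof.
move=> dU pu.
have d1 : der (fun x => U (x + 2 * pi)) u.
  have := der_affine (2 * pi) 1 dU.
  rewrite (_ : (fun x => _) = fun x => U (x + 2 * pi)); last by apply: funext => x; rewrite mul1r.
  by apply: der_ext => x; rewrite !mul1r pu.
by have := der_eq 0 a d1 dU; rewrite add0r; lra.
Qed.

(* The nodes are mean value points of the integral over [2D + 1] separated intervals. *)
Lemma trig_poly_growth D (c : R) : 0 < c -> exists2 C : R, 0 <= C &
  forall p, trig_poly D p -> forall N a phi U, (0 < N)%N -> periodic2pi phi ->
  (forall x, 0 <= phi x) -> (forall x, `|x| * N%:R <= 1 -> c <= phi x) ->
  der U (fun x => `|p x| * phi (x - a)) ->
  forall x, `|p x| <= C * omega N (x - a) ^+ D * (N%:R * (U (2 * pi) - U 0)).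
Proof.
(* The 2 D + 1 intervals and as many gaps, all of length h / e, fill [a, a + h] with h = 1 / N. The
   8 in the separation constant is that of [norm_le_sin_half]. *)
move=> c0; pose e : R := ((D.*2.*2).+2)%:R.
have e0 : 0 < e by rewrite ltr0n.
have d0 : 0 < (8 * e)^-1 by rewrite invr_gt0 mulr_gt0.
have [C C0 hC] := half_form_growth D.*2 d0.
have ec0 : 0 <= e / c by rewrite divr_ge0 // ltW.
have Ce0 : 0 <= C * (e / c) by exact: mulr_ge0.
exists (C * (e / c) * 2 ^+ D); first by rewrite mulr_ge0 // exprn_ge0.
move=> p tp N a phi U N0 pphi phi0 phic dU x.
have N0' : 0 < N%:R :> R by rewrite ltr0n.
pose h : R := N%:R^-1; have h0 : 0 < h by rewrite invr_gt0.
have h1 : h <= 1 by rewrite invf_le1 // ler1n.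
pose dl := h / e; have dl0 : 0 < dl by rewrite divr_gt0.
have mono y y' : y <= y' -> U y <= U y'.
  by apply: der_mono dU _ => t; exact: mulr_ge0.
pose V := U (2 * pi) - U 0.
have VU y y' : a <= y -> y <= y' -> y' <= a + h -> U y' - U y <= V.
  move=> ay yy' y'h; rewrite /V -(der_period a dU); last first.
    move=> t; rewrite (trig_poly_periodic tp); congr (_ * _).
    by rewrite -[RHS]pphi; congr phi; ring.
  by apply: lerB; apply: mono => //; have := pi_ge2 R; lra.
have V0 : 0 <= V.
  by apply: le_trans (VU a a (lexx a) (lexx a) _); [rewrite subrr|rewrite lerDl ltW].
have /choice[t ht] : forall i : nat, exists t, a + i.*2%:R * dl <= t <= a + i.*2.+1%:R * dl /\
    U (a + i.*2.+1%:R * dl) - U (a + i.*2%:R * dl) = `|p t| * phi (t - a) * dl.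
  move=> i; have le : a + i.*2%:R * dl <= a + i.*2.+1%:R * dl.
    by rewrite lerD2l ler_wpM2r ?ler_nat // ltW.
  have [t ht eq] := der_MVT dU le; exists t; split => //.
  by rewrite eq -(natr1 i.*2); congr (_ * _); ring.
have ile i j : (i <= j)%N -> (i%:R * dl <= j%:R * dl) by move=> ij; rewrite ler_wpM2r ?ler_nat // ltW.
have ehl : e * dl = h by rewrite /dl mulrC divfK // gt_eqF.
have rng i : (i <= D.*2)%N -> a <= t i <= a + h /\ a + i.*2.+1%:R * dl <= a + h.
  move=> iD; have [/andP[t1 t2] _] := ht i.
  have h2 : i.*2.+1%:R * dl <= h.
    by rewrite -ehl /e; apply: ile; rewrite ltnS (leq_trans _ (leqnSn _)) // leq_double.
  have : 0 <= i.*2%:R * dl by rewrite mulr_ge0 // ltW.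
  by split; lra.
have := hC p (trig_poly_half_form tp) h a (N%:R * (e / c) * V) t h0.
have B0 : 0 <= N%:R * (e / c) * V by apply: mulr_ge0 => //; exact: mulr_ge0.
move=> /(_ B0) H; have {H} := H _ _ _ x.
have r1 i : (i <= D.*2)%N -> `|sin ((t i - a) / 2)| <= h.
  move=> /rng[/andP[t1 t2] _]; apply: (le_trans (norm_sin_le _)).
  by rewrite ger0_norm; lra.
have r2 i j : (i < j <= D.*2)%N -> (8 * e)^-1 * h <= `|sin ((t j - t i) / 2)|.
  move=> /andP[ij jD]; have iD := leq_trans (ltnW ij) jD.
  have [/andP[a1 a2] _] := ht i; have [/andP[b1 b2] _] := ht j.
  have [/andP[a3 a4] _] := rng i iD; have [/andP[b3 b4] _] := rng j jD.
  have : i.*2.+2%:R * dl <= j.*2%:R * dl by apply: ile; rewrite -doubleS leq_double.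
  rewrite -(natr1 i.*2.+1) mulrDl mul1r => sep.
  have tt : dl <= t j - t i by lra.
  have tp' : `|t j - t i| <= pi by have := pi_ge2 R; rewrite ger0_norm; lra.
  have := norm_le_sin_half tp'; rewrite [X in X <= _]ger0_norm; last by lra.
  have -> : (8 * e)^-1 * h = dl / 8 by rewrite /dl; field; rewrite gt_eqF.
  by lra.
have r3 i : (i <= D.*2)%N -> `|p (t i)| <= N%:R * (e / c) * V.
  move=> iD; have [/andP[a1 a2] eq] := ht i; have [/andP[a3 a4] a5] := rng i iD.
  have le1 : a <= a + i.*2%:R * dl by rewrite lerDl mulr_ge0 // ltW.
  have le2 : a + i.*2%:R * dl <= a + i.*2.+1%:R * dl by lra.
  have := VU _ _ le1 le2 a5; rewrite eq => hV.
  have cphi : c <= phi (t i - a).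
    apply: phic; rewrite ger0_norm ?subr_ge0 // -ler_pdivlMr // mul1r -/h; lra.
  have -> : N%:R * (e / c) * V = V / (c * dl).
    by rewrite /dl /h; field; rewrite !gt_eqF.
  have cdl : 0 < c * dl by exact: mulr_gt0.
  rewrite ler_pdivlMr //; apply: le_trans hV; rewrite mulrA ler_wpM2r ?(ltW dl0) //.
  by rewrite ler_wpM2l.
move=> /(_ r1 r2 r3) => H; apply: (le_trans H).
have -> : C * (N%:R * (e / c) * V) = C * (e / c) * (N%:R * V) by ring.
rewrite -/V [leRHS](_ : _ = C * (e / c) * (N%:R * V) * (2 * omega N (x - a)) ^+ D); last first.
  by rewrite exprMn; ring.
apply: ler_wpM2l; first by apply: mulr_ge0 => //; exact: mulr_ge0.
rewrite -mul2n exprM lerXn2r ?nnegrE ?exprn_even_ge0 //.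
  by rewrite mulr_ge0 // ltW // omega_gt0.
by rewrite /h invrK mulrC; exact: sqr_le_omega.
Qed.

(** On [0, 2 pi] three translates of an arctangent derivative at scale 8 / N dominate the integrand,
    and each integrates to at most 8 / N times 4. *)
Lemma omega_integral : exists2 C : R, 0 <= C & forall N a W, (0 < N)%N -> 0 <= a <= 2 * pi ->
  der W (fun x => (omega N (x - a))^-1) -> W (2 * pi) - W 0 <= C * N%:R^-1.
Proof.
exists 96 => // N a W N0 /andP[a0 a2] dW.
have p0 : 0 < pi :> R := pi_gt0 R.
have N0' : 0 < N%:R :> R by rewrite ltr0n.
pose s : R := N%:R / 8; have s0 : 0 < s by rewrite divr_gt0.
pose B b x : R := s^-1 * atan (s * x + s * (b - a)).
have dB b : der (B b) (fun x => (1 + (s * (x + b - a)) ^+ 2)^-1).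
  apply: der_ext (derZ s^-1 (der_affine (s * (b - a)) s (@der_atan R))) => x.
  by rewrite mulrA mulVf ?gt_eqF // mul1r -mulrDr addrA.
have Bd b : B b (2 * pi) - B b 0 <= 32 * N%:R^-1.
  rewrite /B -mulrBr; have -> : s^-1 = 8 * N%:R^-1 by rewrite /s invf_div.
  set y := atan _; set y' := atan _.
  have y1 : y < pi / 2 by exact: atan_ltpi2.
  have y2 : - (pi / 2) < y' by exact: atan_gtNpi2.
  have p2 := pihalf_lt2 R.
  have -> : 32 * N%:R^-1 = 8 * N%:R^-1 * 4 :> R by ring.
  by apply: ler_wpM2l; [rewrite mulr_ge0 // invr_ge0|lra].
have key (v : int) x : `|x + 2 * pi * v%:~R - a| <= pi ->
    (omega N (x - a))^-1 <= (1 + (s * (x + 2 * pi * v%:~R - a)) ^+ 2)^-1.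
  move=> hx; rewrite -(omega_shift _ _ _ v); set y := _ - a in hx *.
  rewrite lef_pV2 ?posrE ?omega_gt0 ?ltr_wpDr ?exprn_even_ge0 //.
  rewrite omegaE lerD2l -(real_normK (num_real (s * y))) lerXn2r ?nnegrE ?mulr_ge0 //.
  rewrite normrM (gtr0_norm s0) /s; have := norm_le_sin_half hx => hh.
  by rewrite -mulrA ler_wpM2l //; lra.
have dd := derD (derD (dB 0) (dB (2 * pi))) (dB (- (2 * pi))).
have le : 0 <= 2 * pi :> R by rewrite mulr_ge0 // ltW.
have := der_le dW dd le; move=> H.
apply: (le_trans (H _)); last first.
  by have := Bd 0; have := Bd (2 * pi); have := Bd (- (2 * pi)); lra.
move=> x /andP[x0 x2].
have B0 b : 0 <= (1 + (s * (x + b - a)) ^+ 2)^-1 by rewrite invr_ge0 addr_ge0 // exprn_even_ge0.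
have b1 := B0 0; have b2 := B0 (2 * pi); have b3 := B0 (- (2 * pi)).
case: (lerP `|x - a| pi) => h0.
  by have := key 0 x; rewrite mulr0z mulr0 !addr0 in b1 b2 b3 * => /(_ h0); lra.
move: h0; rewrite ltr_normr => /orP[h0|h0].
  have := key (-1) x; rewrite mulrN1z mulrN1 ler_norml.
  by move=> /(_ ltac:(lra)); lra.
have := key 1 x; rewrite mulr1z mulr1 ler_norml.
by move=> /(_ ltac:(lra)); lra.
Qed.

(** On [0, 2 pi] the function sin (v / 2) rises and then falls, so on a subinterval it is smallest
    at an endpoint. This bounds a tail integral by values at its ends. *)
Lemma omega_unimodal N (x u y : R) : 0 <= x -> x <= u -> u <= y -> y <= 2 * pi ->
  (omega N u)^-1 <= (omega N x)^-1 + (omega N y)^-1.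
Proof.
move=> x0 xu uy y2.
have s0 v : 0 <= v -> v <= 2 * pi -> 0 <= sin (v / 2) :> R.
  by move=> v0 v2; apply: sin_ge0_pi; lra.
have key v : 0 <= v -> v <= 2 * pi -> sin (v / 2) <= sin (u / 2) ->
    (omega N u)^-1 <= (omega N v)^-1.
  move=> v0 v2 vu; rewrite lef_pV2 ?posrE ?omega_gt0 // !omegaE lerD2l.
  rewrite lerXn2r ?nnegrE ?mulr_ge0 // ler_wpM2l // !ger0_norm //.
    by apply: s0 => //; lra.
  by apply: s0 => //; lra.
have mono v w : 0 <= v -> v <= w -> w <= pi -> sin (v / 2) <= sin (w / 2) :> R.
  move=> v0; rewrite le_eqVlt => /orP[/eqP -> //|vw wp]; apply: ltW.
  by rewrite ltr_sin ?in_itv /=; lra.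
have i0 v : 0 <= (omega N v)^-1 :> R by rewrite invr_ge0 ltW // omega_gt0.
case: (lerP u pi) => up.
  by apply: (le_trans (key x _ _ (mono x u _ _ _))); rewrite ?lerDl //; lra.
have e v : sin (v / 2) = sin ((2 * pi - v) / 2) :> R.
  by rewrite -[LHS]opprK -sinN -sinDpi; congr sin; lra.
apply: (le_trans (key y _ _ _)); rewrite ?lerDr //; first by lra.
by rewrite (e y) (e u); apply: mono; lra.
Qed.

End Growth.

(** * Approximation with the sign of [P], where |[P]| controls the distance to the points [z i] *)

Section SignPreservingApproximation.
Variables (R : realType) (n d : nat) (z : 'I_n -> R) (P : R -> R) (ell : 'I_n -> R -> R) (cP : R).
Implicit Types (g p : R -> R) (a x y L : R) (N m k : nat).
Hypothesis tP : trig_poly d P.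
Hypothesis tell : forall i, trig_poly d (ell i).
Hypothesis ellz : forall i j, ell i (z j) = (i == j)%:R.
Hypothesis P_lower : forall x, exists i, `|sin ((x - z i) / 2)| <= cP * `|P x|.

(** With X = N sin (x / 2) and Y alike, factor X^2 - Y^2: |X - Y| <= N |x - y| <= 1, and |X + Y| <=
    2 |X| + 1 <= 3 (1 + X^2). *)
Lemma omega_near N x y : N%:R * `|x - y| <= 1 ->
  `|omega N x - omega N y| <= 3 * (N%:R * `|x - y|) * omega N x.
Proof.
set u := N%:R * `|x - y| => u1.
have u0 : 0 <= u by rewrite mulr_ge0.
have hs : `|N%:R * sin (x / 2) - N%:R * sin (y / 2)| <= u.
  rewrite -mulrBr normrM normr_nat ler_wpM2l //.
  have := @der_lip _ _ _ (y / 2) (x / 2) 1 (@der_sin R) (fun c _ => cos_max c).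
  rewrite mul1r -mulrBl normrM (@ger0_norm _ 2^-1) ?invr_ge0 // => h.
  by have := normr_ge0 (x - y); lra.
rewrite /omega -!exprMn opprD addrACA subrr add0r subr_sqr normrM.
set X := N%:R * sin (x / 2) in hs *; set Y := N%:R * sin (y / 2) in hs *.
have hX : `|X| <= 1 + X ^+ 2.
  rewrite -(real_normK (num_real X)); have : 0 <= (`|X| - 1 / 2) ^+ 2 by exact: exprn_even_ge0.
  by rewrite sqrrB; lra.
have X2 : 0 <= X ^+ 2 by exact: exprn_even_ge0.
have hXY : `|X + Y| <= 3 * (1 + X ^+ 2).
  rewrite (_ : X + Y = X + X - (X - Y)); last by ring.
  apply: (le_trans (ler_normB _ _)); have := ler_normD X X; lra.
rewrite [leRHS](_ : _ = u * (3 * (1 + X ^+ 2))); last by ring.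
by rewrite ler_pM.
Qed.

Lemma omegaX_near m : exists2 B : R, 0 <= B & forall N x y, N%:R * `|x - y| <= 1 ->
  `|omega N x ^+ m - omega N y ^+ m| <= B * (N%:R * `|x - y|) * omega N x ^+ m.
Proof.
elim: m => [|m [B B0 IH]].
  by exists 0 => // N x y _; rewrite !expr0 subrr normr0 !mul0r.
exists (B + 4 ^+ m * 3); first by rewrite addr_ge0 // mulr_ge0 // exprn_ge0.
move=> N x y h; have h1 := IH N x y h; have h2 := omega_near h.
have u0 : 0 <= N%:R * `|x - y| by rewrite mulr_ge0.
have w0 := omega_gt0 N x; have w0' := omega_gt0 N y.
have wy : omega N y <= 4 * omega N x.
  have : - (omega N x - omega N y) <= 3 * (N%:R * `|x - y|) * omega N x.
    by apply: le_trans h2; rewrite -normrN ler_norm.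
  by nra.
have -> : omega N x ^+ m.+1 - omega N y ^+ m.+1 = omega N x * (omega N x ^+ m - omega N y ^+ m)
    + omega N y ^+ m * (omega N x - omega N y) by rewrite !exprS; ring.
apply: (le_trans (ler_normD _ _)); rewrite !normrM [X in X * _ + _](gtr0_norm w0).
rewrite [X in _ + X * _]ger0_norm; last by rewrite exprn_ge0 // ltW.
have wm : omega N y ^+ m <= 4 ^+ m * omega N x ^+ m.
  by rewrite -exprMn lerXn2r // nnegrE ?mulr_ge0 // ltW.
set u := N%:R * _ in h h1 h2 u0 *; set wx := omega N x in h1 h2 w0 wy wm *.
rewrite [leRHS](_ : _ = wx * (B * u * wx ^+ m) + 4 ^+ m * wx ^+ m * (3 * u * wx)).
  apply: lerD; first by rewrite ler_wpM2l // ltW.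
  by rewrite ler_pM // exprn_ge0 // ltW.
by rewrite exprS; ring.
Qed.

(* The values of the local approximation at the zeros are removed by multiples of
   [ell i * omega ^+ k.+1], whose growth away from [a] compensates the distance to the zero. *)
Lemma corrected_approx k L : 0 <= L -> exists D K (C : R), 0 <= C /\
  forall g, lipschitz_class k L g -> (forall i, g (z i) = 0) -> forall N a, (0 < N)%N ->
  exists G, trig_poly D G /\ forall x,
    `|g x - G x| <= C * N%:R^-1 ^+ k.+1 * omega N (x - a) ^+ K /\
    `|g x - G x| <= C * N%:R^-1 ^+ k * `|P x| * omega N (x - a) ^+ K.
Proof.
move=> L0; have [D0 [C0 [C0_ge0 hG]]] := local_approx k L0.
have [A A0 hA] : exists2 A : R, 0 <= A & forall i,
    (forall x, `|ell i x| <= A) /\ (forall x y, `|ell i x - ell i y| <= A * `|x - y|).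
  have h i : exists A : R, [/\ 0 <= A, (forall x, `|ell i x| <= A) &
      (forall x y, `|ell i x - ell i y| <= A * `|x - y|)].
    have [A1 A1_0 h1] := trig_poly_bounded (tell i).
    have [A2 A2_0 h2] := trig_poly_lipschitz (tell i).
    exists (A1 + A2); split; first exact: addr_ge0.
      by move=> x; rewrite (le_trans (h1 x)) // lerDl.
    by move=> x y; rewrite (le_trans (h2 x y)) // ler_wpM2r // lerDr.
  have [A hA] := fin_all_exists h.
  have Ai i : A i <= \sum_j A j.
    by rewrite (bigD1 i) //= lerDl sumr_ge0 // => j _; have [] := hA j.
  exists (\sum_i A i); first by rewrite sumr_ge0 // => i _; have [] := hA i.
  move=> i; have [_ h1 h2] := hA i; split=> [x|x y].
    exact: le_trans (h1 x) (Ai i).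
  by apply: le_trans (h2 x y) _; rewrite ler_wpM2r.
have [B B0 hB] := omegaX_near k.+1.
(* For x within pi of [a], |x - a| <= 8 |sin ((x - a) / 2)| <= 8 h [omega], with h = 1 / N. *)
pose C1 := C0 * 8 ^+ k.+1.
have C1_0 : 0 <= C1 by rewrite mulr_ge0 // exprn_ge0.
(* [Ca] measures the corrected error in units of h^(k+1); [Cb] measures its variation between points
   at distance t <= h in units of h^k t. *)
pose Ca := C1 + n%:R * (C1 * A).
pose Cb := C0 * 9 ^+ k + n%:R * (C1 * (A * (1 + B))).
have nA0 : 0 <= n%:R * (C1 * A) :> R by rewrite !mulr_ge0.
have Ca0 : 0 <= Ca by rewrite addr_ge0.
have Cb0 : 0 <= Cb by rewrite addr_ge0 // !mulr_ge0 ?exprn_ge0 // addr_ge0.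
pose C := Ca + (Ca + Cb) * (8 * `|cP|).
exists (maxn D0 (d + k.+1)), k.+1, C.
have CC : 0 <= (Ca + Cb) * (8 * `|cP|).
  by apply: mulr_ge0; [exact: addr_ge0|exact: mulr_ge0].
have C_ge0 : 0 <= C by exact: addr_ge0.
split=> // g hg gz N a N0.
have [G [tG Ga hGa]] := hG g hg a.
have N0' : 0 < N%:R :> R by rewrite ltr0n.
have N1 : 1 <= N%:R :> R by rewrite ler1n.
set h : R := N%:R^-1; have h0 : 0 < h by rewrite invr_gt0.
have hN : h * N%:R = 1 by rewrite mulVf // gt_eqF.
pose w x := omega N (x - a).
have w1 x : 1 <= w x by exact: omega_ge1.
have w0 x : 0 < w x by exact: omega_gt0.
pose E x := g x - G x.
have pE : periodic2pi E.
  by move=> x; rewrite /E (lipschitz_class_periodic hg) (trig_poly_periodic tG).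
have E1 x : `|E x| <= C1 * h ^+ k.+1 * w x ^+ k.+1.
  have [v hv] := near_mod_2pi a x.
  rewrite -(periodic2piz x v pE).
  have := hGa (x + 2 * pi * v%:~R) a; rewrite Ga subrr subr0 -/(E _).
  set x' := x + _ in hv *.
  rewrite subrr normr0 (max_idPl (normr_ge0 (x' - a))) -mulrA -exprS => hE.
  apply: (le_trans hE); rewrite /C1 -!mulrA ler_wpM2l // -!exprMn lerXn2r ?nnegrE //.
    by rewrite !mulr_ge0 ?(ltW h0) ?(ltW (w0 _)).
  apply: (le_trans (norm_le_sin_half hv)); rewrite ler_wpM2l //.
  rewrite norm_sin_half_shift ler_pdivlMl //; exact: le_omega.
pose c i := G (z i) / w (z i) ^+ k.+1.
have hc i : `|c i| <= C1 * h ^+ k.+1.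
  rewrite /c normrM normfV [X in _ / X]ger0_norm ?exprn_ge0 ?(ltW (w0 _)) //.
  rewrite ler_pdivrMr ?exprn_gt0 //; have := E1 (z i).
  by rewrite /E gz sub0r normrN.
pose T x := \sum_i c i * (ell i x * w x ^+ k.+1).
have tT : trig_poly (d + k.+1) T.
  apply: trig_poly_sum => i; apply: trig_polyZ; apply: trig_polyM => //.
  by have := trig_polyX k.+1 (trig_poly_omega N a); rewrite mul1n.
exists (fun x => G x - T x).
have pT : periodic2pi T := trig_poly_periodic tT.
pose e x := g x - (G x - T x).
have eE x : e x = E x + T x by rewrite /e /E; ring.
have pe : periodic2pi e by move=> x; rewrite !eE pE pT.
have ez i : e (z i) = 0.
  rewrite /e gz /T (bigD1 i) //= ellz eqxx mul1r big1 => [|j ji].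
    by rewrite addr0 /c divfK ?subrr ?subr0 // gt_eqF // exprn_gt0.
  by rewrite ellz (negbTE ji) mul0r mulr0.
have ea x : `|e x| <= Ca * h ^+ k.+1 * w x ^+ k.+1.
  rewrite eE; apply: (le_trans (ler_normD _ _)).
  rewrite /Ca mulrDl [leRHS]mulrDl; apply: lerD; first exact: E1.
  apply: (le_trans (ler_norm_sum _ _ _)).
  apply: (@le_trans _ _ (\sum_(i < n) C1 * h ^+ k.+1 * (A * w x ^+ k.+1))).
    apply: ler_sum => i _; rewrite normrM ler_pM // normrM.
    rewrite [X in _ * X]ger0_norm ?exprn_ge0 ?(ltW (w0 _)) // ler_wpM2r ?exprn_ge0 ?(ltW (w0 _)) //.
    exact: (hA i).1.
  rewrite sumr_const card_ord -mulr_natl le_eqVlt; apply/orP; left; apply/eqP; ring.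
have wsh x v : w (x + 2 * pi * v%:~R) = w x by exact: omega_shift.
have CaC : Ca <= C by rewrite lerDl.
split.
  apply: trig_polyD; first by apply: trig_poly_widen tG; exact: leq_maxl.
  rewrite (_ : (fun x => _) = fun x => -1 * T x); last by apply: funext => x; rewrite mulN1r.
  by apply: trig_polyZ; apply: trig_poly_widen tT; exact: leq_maxr.
move=> x0; split.
  apply: (le_trans (ea x0)); rewrite -!mulrA ler_wpM2r // mulr_ge0 ?exprn_ge0 ?(ltW h0) //.
  exact: ltW (w0 _).
have [v hv] := near_mod_2pi a x0.
rewrite -/(e x0) -/(w x0) -(periodic2piz x0 v pe) -(wsh x0 v).
rewrite -(periodic2piz x0 v (trig_poly_periodic tP)).
move: (x0 + _) hv => {x0 v} x hv.
have [i hi] := P_lower x.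
have [v hy] := near_mod_2pi x (z i); set y := z i + _ in hy.
have ey : e y = 0 by rewrite /y periodic2piz // ez.
pose t := `|x - y|.
have t0 : 0 <= t by exact: normr_ge0.
have tle : t <= 8 * `|cP| * `|P x|.
  rewrite /t distrC; apply: (le_trans (norm_le_sin_half hy)).
  rewrite norm_sin_half_shift -mulrA ler_wpM2l // -opprB mulNr sinN normrN.
  by apply: (le_trans hi); rewrite ler_wpM2r // ler_norm.
have hk0 : 0 <= h ^+ k by rewrite exprn_ge0 // ltW.
suff het : `|e x| <= (Ca + Cb) * h ^+ k * t * w x ^+ k.+1.
  apply: (le_trans het); rewrite ler_wpM2r ?exprn_ge0 ?(ltW (w0 _)) //.
  apply: (@le_trans _ _ ((Ca + Cb) * h ^+ k * (8 * `|cP| * `|P x|))).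
    by apply: ler_wpM2l => //; apply: mulr_ge0 => //; exact: addr_ge0.
  rewrite /C; have : 0 <= Ca * h ^+ k * `|P x| by rewrite !mulr_ge0.
  by lra.
have wk0 : 0 <= w x ^+ k.+1 by rewrite exprn_ge0 // ltW.
(* Farther than h from the zero, the global bound suffices because h^(k+1) <= h^k t. Closer to it,
   the error is estimated by its increment from the zero, where it vanishes. *)
case: (lerP (N%:R * t) 1) => Nt; last first.
  apply: (le_trans (ea x)); rewrite ler_wpM2r // exprS.
  have ht : h <= t.
    by rewrite -[leLHS]mulr1 ler_pdivrMl // ltW.
  have : Ca * h ^+ k * h <= Ca * h ^+ k * t by rewrite ler_wpM2l // mulr_ge0.
  have : 0 <= Cb * h ^+ k * t by rewrite !mulr_ge0.
  by lra.
have -> : e x = (E x - E y) + (T x - T y).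
  by rewrite -[LHS]subr0 -ey !eE; ring.
apply: (le_trans (ler_normD _ _)).
have h1 : `|E x - E y| <= C0 * 9 ^+ k * h ^+ k * t * w x ^+ k.+1.
  apply: (le_trans (hGa x y)); rewrite -/t.
  have hm : Num.max `|x - a| `|y - a| <= 9 * h * w x.
    have hxa : `|x - a| <= 8 * h * w x.
      apply: (le_trans (norm_le_sin_half hv)); rewrite -mulrA ler_wpM2l //.
      rewrite ler_pdivlMl //; exact: le_omega.
    have hxt : t <= h * w x.
      have : t <= h by rewrite -[leRHS]mulr1 ler_pdivlMl.
      by have := w1 x; nra.
    have hya : `|y - a| <= t + `|x - a|.
      by have := ler_normD (y - x) (x - a); rewrite addrA subrK /t (distrC x y).
    by rewrite ge_max; apply/andP; split; nra.
  apply: (@le_trans _ _ (C0 * t * (9 * h * w x) ^+ k)).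
    apply: ler_wpM2l; first exact: mulr_ge0.
    have m0 : 0 <= Num.max `|x - a| `|y - a| by rewrite le_max normr_ge0.
    by apply: lerXn2r => //; rewrite nnegrE; exact: le_trans hm.
  rewrite !exprMn.
  rewrite [leRHS](_ : _ = C0 * t * (9 ^+ k * h ^+ k * w x ^+ k.+1)); last by ring.
  apply: ler_wpM2l; first exact: mulr_ge0.
  have w0k : 0 <= w x ^+ k by rewrite exprn_ge0 // ltW.
  have k0 : 0 <= 9 ^+ k * h ^+ k by rewrite mulr_ge0 // exprn_ge0.
  by apply: ler_wpM2l => //; rewrite exprS ler_peMl.
have h2 : `|T x - T y| <= n%:R * (C1 * (A * (1 + B))) * h ^+ k * t * w x ^+ k.+1.
  rewrite /T -sumrB; apply: (le_trans (ler_norm_sum _ _ _)).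
  apply: (@le_trans _ _ (\sum_(i < n) C1 * h ^+ k.+1 * (A * (1 + B) * (N%:R * t) * w x ^+ k.+1))).
    apply: ler_sum => j _; rewrite -mulrBr normrM ler_pM //.
    have -> : ell j x * w x ^+ k.+1 - ell j y * w y ^+ k.+1 =
      (ell j x - ell j y) * w x ^+ k.+1 + ell j y * (w x ^+ k.+1 - w y ^+ k.+1) by ring.
    apply: (le_trans (ler_normD _ _)); rewrite !normrM.
    have b1 : `|ell j x - ell j y| <= A * (N%:R * t).
      apply: (le_trans ((hA j).2 x y)); rewrite ler_wpM2l // -/t.
      by rewrite ler_peMl.
    have b2 : `|w x ^+ k.+1 - w y ^+ k.+1| <= B * (N%:R * t) * w x ^+ k.+1.
      have := hB N (x - a) (y - a); rewrite (_ : x - a - (y - a) = x - y) -/t; last by ring.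
      exact.
    rewrite [leRHS](_ : _ = A * (N%:R * t) * w x ^+ k.+1 +
      A * (B * (N%:R * t) * w x ^+ k.+1)); last by ring.
    apply: lerD; last by rewrite ler_pM // (hA j).1.
    by rewrite [X in _ * X]ger0_norm // ler_wpM2r.
  rewrite sumr_const card_ord -mulr_natl le_eqVlt; apply/orP; left; apply/eqP.
  rewrite exprS [LHS](_ : _ = n%:R * (C1 * (A * (1 + B))) * h ^+ k * t * w x ^+ k.+1 *
    (h * N%:R)); first by rewrite hN mulr1.
  by ring.
have h3 : 0 <= Ca * h ^+ k * t * w x ^+ k.+1 by rewrite !mulr_ge0.
apply: (le_trans (lerD h1 h2)); rewrite -subr_ge0 /Cb.
by apply: (le_trans h3); rewrite le_eqVlt; apply/orP; left; apply/eqP; ring.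
Qed.

(* The correction, a multiple of [omega ^+ K.+1 * P / (N |P a| + 1)], has the sign of [P], dominates
   the error even near the zeros of [P], and is no larger than the error near [a]. *)
Lemma sign_approx k L : 0 <= L -> exists D K (C : R), 0 <= C /\
  forall g, lipschitz_class k L g -> (forall i, g (z i) = 0) -> (forall x, 0 <= g x * P x) ->
  forall N a, (0 < N)%N -> exists p, [/\ trig_poly D p, (forall x, 0 <= p x * P x),
    (forall x, `|p x| = `|g x| + `|p x - g x|) &
    (forall x, `|p x - g x| <= C * N%:R^-1 ^+ k.+1 * omega N (x - a) ^+ K)].
Proof.
move=> L0; have [D0 [K [C [C0 hC]]]] := corrected_approx k L0.
have [LP LP0 hLP] := trig_poly_lipschitz_sin tP.
pose C2 := 2 * C * (LP + 1).
have C20 : 0 <= C2 by rewrite !mulr_ge0 // addr_ge0.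
exists (maxn D0 (K.+1 + d)), K.+2, (C + C2 * (LP + 1)).
split; first by rewrite addr_ge0 // mulr_ge0 // addr_ge0.
move=> g hg gz gP N a N0.
have [G [tG hG]] := hC g hg gz N a N0.
have N0' : 0 < N%:R :> R by rewrite ltr0n.
set h : R := N%:R^-1 in hG *; have h0 : 0 < h by rewrite invr_gt0.
have hN : h * N%:R = 1 by rewrite mulVf // gt_eqF.
(* The ideal coefficient would involve N |P x| + 1, which is not a polynomial in x. Freezing the
   point at [a] costs only factors (LP + 1) [omega], by [PQ] and [QP]. *)
set Q := N%:R * `|P a| + 1.
have Q0 : 0 < Q by rewrite ltr_wpDl // mulr_ge0.
pose w x := omega N (x - a).
have w1 x : 1 <= w x by exact: omega_ge1.
have w0 x : 0 < w x by exact: omega_gt0.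
have hk0 : 0 < h ^+ k.+1 by rewrite exprn_gt0.
pose U x := C2 * h ^+ k.+1 * w x ^+ K.+1 * (N%:R / Q).
have wK x j : 0 <= w x ^+ j by rewrite exprn_ge0 // ltW.
have U0 x : 0 <= U x.
  apply: mulr_ge0; last by rewrite divr_ge0 // ltW.
  by apply: mulr_ge0 => //; apply: mulr_ge0 => //; exact: ltW.
pose p x := G x + U x * P x.
pose t x := N%:R * `|P x|.
have t0 x : 0 <= t x by rewrite mulr_ge0.
have PQ x : Q <= (t x + 1) * ((LP + 1) * w x).
  have : `|P a| <= `|P x| + LP * `|sin ((x - a) / 2)|.
    by have := hLP x a; have := ler_normB (P x) (P x - P a); rewrite opprB addrCA subrr addr0; lra.
  move=> /(ler_wpM2l (ltW N0')); have := le_omega N (x - a); rewrite -/(w x).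
  have := w1 x; have := t0 x; rewrite /Q /t; set S := `|sin _|; set X := N%:R * `|P x|.
  move=> X0 w1' NS; rewrite mulrDr -/X mulrCA => hP.
  have : LP * (N%:R * S) <= LP * w x by rewrite ler_wpM2l.
  have : 0 <= X * (w x - 1) by rewrite mulr_ge0 // subr_ge0.
  have : 0 <= LP * X * w x by rewrite !mulr_ge0 // ltW.
  by lra.
have QP x : t x <= Q * ((LP + 1) * w x).
  have : `|P x| <= `|P a| + LP * `|sin ((x - a) / 2)|.
    by have := hLP x a; have := ler_normD (P a) (P x - P a); rewrite addrCA subrr addr0; lra.
  move=> /(ler_wpM2l (ltW N0')); have := le_omega N (x - a); rewrite -/(w x).
  have := w1 x; have : 0 <= N%:R * `|P a| by rewrite mulr_ge0.
  rewrite /Q /t; set S := `|sin _|; set X := N%:R * `|P a|.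
  move=> X0 w1' NS; rewrite mulrDr -/X mulrCA => hP.
  have : LP * (N%:R * S) <= LP * w x by rewrite ler_wpM2l.
  have : 0 <= X * (w x - 1) by rewrite mulr_ge0 // subr_ge0.
  have : 0 <= LP * X * w x by rewrite !mulr_ge0 // ltW.
  by lra.
have UP x : U x * `|P x| = C2 * h ^+ k.+1 * w x ^+ K.+1 * (t x / Q).
  by rewrite /U /t; ring.
have eU x : `|g x - G x| <= U x * `|P x|.
  have [e1 e2] := hG x; rewrite -/(w x) in e1 e2.
  (* The first error bound is multiplied by [t x] and added to the second, which is the same
     quantity once N h = 1 is inserted. So the error carries the factor t / (t + 1), as the
     correction does. *)
  have e3 : `|g x - G x| * (t x + 1) <= 2 * C * h ^+ k.+1 * w x ^+ K * t x.
    have a1 : `|g x - G x| * t x <= C * h ^+ k.+1 * w x ^+ K * t x by rewrite ler_wpM2r.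
    have a2 : C * h ^+ k * `|P x| * w x ^+ K = C * h ^+ k.+1 * w x ^+ K * t x.
      rewrite /t exprS [RHS](_ : _ = C * h ^+ k * `|P x| * w x ^+ K * (h * N%:R)); last by ring.
      by rewrite hN mulr1.
    by rewrite a2 in e2; lra.
  rewrite UP mulrA ler_pdivlMr //.
  apply: (le_trans (ler_wpM2l (normr_ge0 _) (PQ x))).
  rewrite mulrA; apply: (@le_trans _ _ (2 * C * h ^+ k.+1 * w x ^+ K * t x * ((LP + 1) * w x))).
    by rewrite ler_wpM2r // mulr_ge0 ?(ltW (w0 _)) // addr_ge0.
  by rewrite le_eqVlt /C2 [w x ^+ K.+1]exprS; apply/orP; left; apply/eqP; ring.
have pg x : p x - g x = U x * P x - (g x - G x) by rewrite /p; ring.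
have pgP x : 0 <= (p x - g x) * P x.
  rewrite pg mulrBl subr_ge0 -mulrA -expr2.
  apply: (le_trans (ler_norm _)); rewrite normrM.
  apply: (le_trans (ler_wpM2r (normr_ge0 _) (eU x))).
  by rewrite -mulrA -expr2 real_normK ?num_real.
have pU x : `|p x - g x| <= 2 * (U x * `|P x|).
  rewrite pg; apply: (le_trans (ler_normB _ _)); rewrite normrM (ger0_norm (U0 x)).
  by have := eU x; lra.
exists p; split.
- apply: trig_polyD; first by apply: trig_poly_widen tG; exact: leq_maxl.
  apply: (@trig_poly_widen _ (K.+1 + d)); first exact: leq_maxr.
  apply: trig_polyM => //.
  rewrite (_ : U = fun x => C2 * h ^+ k.+1 * (N%:R / Q) * w x ^+ K.+1); last first.
    by apply: funext => x; rewrite /U; ring.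
  by apply: trig_polyZ; have := trig_polyX K.+1 (trig_poly_omega N a); rewrite mul1n.
- by move=> x; have := pgP x; have := gP x; nra.
(* Where [P] is nonzero, [g] and [p - g] both have its sign, so their absolute values add up; where
   it vanishes, [pU] forces [p = g]. *)
- move=> x; have := pgP x; have := gP x; have := pU x.
  case: (ltrgt0P (P x)) => Px.
  + rewrite !pmulr_lge0 // => _ g0 pg0.
    by rewrite !ger0_norm //; lra.
  + rewrite !nmulr_lge0 // => _ g0 pg0.
    by rewrite !ler0_norm //; lra.
  + rewrite !mulr0 normr_le0 subr_eq0 => /eqP -> _ _.
    by rewrite subrr normr0 addr0.
- move=> x.
  rewrite pg; apply: (le_trans (ler_normB _ _)); rewrite normrM (ger0_norm (U0 x)) UP addrC.
  have [e1 _] := hG x; rewrite -/(w x) -/h in e1 *.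
  rewrite mulrDl [leRHS]mulrDl; apply: lerD.
    apply: (le_trans e1); apply: ler_wpM2l; first by apply: mulr_ge0 => //; exact: ltW.
    by apply: ler_weXn2l => //; exact: leqW (leqnSn _).
  have := QP x; rewrite mulrC -ler_pdivrMr // => q1.
  apply: (@le_trans _ _ (C2 * h ^+ k.+1 * w x ^+ K.+1 * ((LP + 1) * w x))).
    apply: ler_wpM2l => //; apply: mulr_ge0 => //; apply: mulr_ge0 => //; exact: ltW.
  by rewrite le_eqVlt [w x ^+ K.+2]exprS; apply/orP; left; apply/eqP; ring.
Qed.

(** Some [z i] is within a multiple of |P a| of [a], so [omega (z i - a)] is at most a multiple of 1
    + N^2 P(a)^2. At points x across a zero, P(a) is in turn controlled by the distance from x to
    [a], and the inequality trades a factor of [omega (x - a)] for decay between [a] and the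
    zeros. *)
Lemma zeros_far N a x : 1 <= (1 + cP ^+ 2) * (omega N (x - a) + N%:R ^+ 2 * P a ^+ 2) *
  (\sum_i (omega N (z i - a))^-1).
Proof.
have [i hi] := P_lower a.
have w0 := omega_gt0 N (z i - a).
have hw : omega N (z i - a) <= (1 + cP ^+ 2) * (1 + N%:R ^+ 2 * P a ^+ 2).
  rewrite omega_sub omegaE exprMn.
  have : `|sin ((a - z i) / 2)| ^+ 2 <= (cP * `|P a|) ^+ 2.
    by rewrite lerXn2r ?nnegrE // (le_trans _ hi).
  rewrite exprMn (real_normK (num_real (P a))) => h2.
  have N2 : 0 <= N%:R ^+ 2 :> R by exact: exprn_even_ge0.
  have := ler_wpM2l N2 h2.
  have c2 : 0 <= cP ^+ 2 by exact: exprn_even_ge0.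
  have P2 : 0 <= P a ^+ 2 by exact: exprn_even_ge0.
  have : 0 <= N%:R ^+ 2 * P a ^+ 2 by exact: mulr_ge0.
  by lra.
have hs : (omega N (z i - a))^-1 <= \sum_i (omega N (z i - a))^-1.
  rewrite (bigD1 i) //= lerDl sumr_ge0 // => j _; by rewrite invr_ge0 ltW // omega_gt0.
have h1 : (1 + cP ^+ 2) * (1 + N%:R ^+ 2 * P a ^+ 2) <=
    (1 + cP ^+ 2) * (omega N (x - a) + N%:R ^+ 2 * P a ^+ 2).
  by rewrite ler_wpM2l ?lerD2r ?omega_ge1 // addr_ge0 // exprn_even_ge0.
rewrite -[leLHS](mulfV (lt0r_neq0 w0)); apply: ler_pM => //; first exact: ltW.
  by rewrite invr_ge0 ltW.
exact: le_trans hw h1.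
Qed.

(** Treats a single node [a]. The exponent [m] comes before [C0] and [c] because the kernel depends
    on it. The increment of [E] up to x is always reduced to a tail that avoids the peak at [a],
    plus the balanced full integral when x lies beyond [a]. *)
Lemma sign_cell k L : 0 <= L -> exists D m, (0 < m)%N /\
  forall C0 c : R, 0 <= C0 -> 0 < c -> exists C : R, 0 <= C /\
  forall g, lipschitz_class k L g -> (forall i, g (z i) = 0) -> (forall x, 0 <= g x * P x) ->
  forall N a phi, (0 < N)%N -> 0 <= a <= 2 * pi -> continuous phi -> periodic2pi phi ->
  (forall x, 0 <= phi x) -> (forall x, phi x <= C0 * omega N x ^- m) ->
  (forall x, `|x| * N%:R <= 1 -> c <= phi x) ->
  exists q, [/\ trig_poly D q, (forall x, 0 <= q x * P x) &
    forall E, der E (fun x => (q x - g x) * phi (x - a)) -> forall x, 0 <= x <= 2 * pi ->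
    `|E x - E 0| <= C * N%:R^-1 ^+ k.+2 *
      (\sum_i (omega N (z i - a))^-1 + (omega N (x - a))^-1 + (omega N (0 - a))^-1)].
Proof.
move=> L0; have [D [K [C1 [C1_0 hp]]]] := sign_approx k L0.
(* [K] powers of [omega] absorb the growth of p - g and [D] that of p; of the two spare ones, one
   makes the error integrable with total O(1/N) and the other supplies decay. *)
exists D, (K + D).+2; split=> // C0 c C0_0 c0.
have [C2 C2_0 hgrow] := trig_poly_growth D c0.
have [C3 C3_0 hint] := omega_integral R.
have [LP LP0 hLP] := trig_poly_lipschitz_sin tP.
pose C4 := C2 * (C1 * C0 * C3) + C1.
have C4_0 : 0 <= C4 by rewrite addr_ge0 // !mulr_ge0.
pose C5 := C4 * C0.
have C5_0 : 0 <= C5 by exact: mulr_ge0.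
pose C6 := (1 + cP ^+ 2) * (1 + LP ^+ 2).
have C6_0 : 0 <= C6 by rewrite mulr_ge0 // addr_ge0 // exprn_even_ge0.
exists (C5 * C3 * (2 * C6 + 1)); split; first by rewrite !mulr_ge0 // addr_ge0 // mulr_ge0.
move=> g hg gz gP N a phi N0 a2 cphi pphi phi0 phiw phic.
have [p [tp pP pg pe]] := hp g hg gz gP N a N0.
have N0' : 0 < N%:R :> R by rewrite ltr0n.
set h : R := N%:R^-1; have h0 : 0 < h by rewrite invr_gt0.
have p0 : 0 < pi :> R := pi_gt0 R.
have pp : 0 <= 2 * pi :> R by rewrite mulr_ge0 // ltW.
pose w x := omega N (x - a).
have w1 x : 1 <= w x by exact: omega_ge1.
have w0 x : 0 < w x by exact: omega_gt0.
have wK x j : 0 <= w x ^+ j by rewrite exprn_ge0 // ltW.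
have wV x : 0 <= (w x)^-1 by rewrite invr_ge0 ltW.
have hk j : 0 <= h ^+ j by rewrite exprn_ge0 // ltW.
have cont (u : R -> R) : continuous u -> continuous (fun x => u x * phi (x - a)).
  move=> cu x; apply: cvgM; first exact: cu.
  by apply: (@continuous_comp _ _ _ (fun x => x - a) phi); [apply: cvgB; [exact: cvg_id|exact: cvg_cst]|exact: cphi].
have cnorm (u : R -> R) : continuous u -> continuous (fun x => `|u x|).
  by move=> cu x; apply: cvg_norm; exact: cu.
have cg : continuous g by exact: lipschitz_class_continuous hg.
have cp : continuous p by exact: trig_poly_continuous tp.
have [A dA] := antiderivative (cont _ (cnorm _ cg)).
have [B dB] := antiderivative (cont _ (cnorm _ cp)).
have [W dW] : exists W, der W (fun x => (w x)^-1).
  apply: antiderivative => x; apply: cvgV; first by rewrite gt_eqF.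
  exact: (trig_poly_continuous (trig_poly_omega N a)).
have hW : W (2 * pi) - W 0 <= C3 * h by exact: (hint N a W N0 a2 dW).
have mW x y : x <= y -> W x <= W y by move=> xy; exact: der_mono dW wV xy.
have phia x : 0 <= phi (x - a) by exact: phi0.
set al := A (2 * pi) - A 0; set be := B (2 * pi) - B 0.
have al0 : 0 <= al.
  by rewrite subr_ge0; apply: der_mono dA _ _ => // x; exact: mulr_ge0.
have be_al : be - al <= C1 * C0 * C3 * h ^+ k.+2.
  have := der_le (derB dB dA) (derZ (C1 * C0 * h ^+ k.+1) dW) pp.
  rewrite -!mulrBr => H.
  have -> : be - al = B (2 * pi) - A (2 * pi) - (B 0 - A 0) by rewrite /be /al; ring.
  apply: (le_trans (H _)) => [x _|]; last first.
    have -> : C1 * C0 * C3 * h ^+ k.+2 = C1 * C0 * h ^+ k.+1 * (C3 * h) by rewrite exprSr; ring.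
    by apply: ler_wpM2l => //; rewrite !mulr_ge0.
  rewrite -mulrBl pg addrAC subrr add0r.
  apply: (le_trans (ler_pM _ _ (pe x) (phiw (x - a)))) => //; rewrite -/(w x) -/h.
  rewrite [leRHS](_ : _ = C1 * h ^+ k.+1 * C0 * (w x)^-1); last by ring.
  rewrite mulrACA mulrA [leLHS](_ : _ = C1 * h ^+ k.+1 * C0 * (w x ^+ K * (w x ^- (K + D).+2))); last by ring.
  apply: ler_wpM2l; first by rewrite !mulr_ge0.
  rewrite -[leRHS]mul1r ler_pdivlMr // mulrAC ler_pdivrMr ?exprn_gt0 // mul1r -exprSr.
  by apply: ler_weXn2l => //; rewrite ltnS leqW // leq_addr.
have be_al0 : 0 <= be - al.
  have -> : be - al = (B (2 * pi) - A (2 * pi)) - (B 0 - A 0) by rewrite /be /al; ring.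
  rewrite subr_ge0; apply: der_mono (derB dB dA) _ _ => // x.
  by rewrite -mulrBl pg addrAC subrr add0r mulr_ge0.
(* If [be] is 0 the quotient is 0 by convention, and [0 <= al <= be] makes [al] vanish too, so
   [thbe] holds in every case. *)
set th := al / be.
have thbe : th * be = al.
  rewrite /th; case: (eqVneq be 0) => [be0|be0]; last by rewrite divfK.
  by rewrite be0 mulr0; apply/eqP; rewrite eq_le al0 /=; rewrite be0 in be_al0; lra.
have th0 : 0 <= th by rewrite divr_ge0 //; lra.
have th1 : th <= 1.
  rewrite /th; case: (eqVneq be 0) => [->|be0]; first by rewrite invr0 mulr0.
  by rewrite ler_pdivrMr ?mul1r; [lra|rewrite lt_neqAle eq_sym be0; lra].
(* The growth bound gives |p| in terms of N [be], and (1 - th) [be] equals [be - al], which is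
   O(h^(k+2)). *)
have grow x : (1 - th) * `|p x| <= C2 * (C1 * C0 * C3) * h ^+ k.+1 * w x ^+ D.
  have := hgrow p tp N a phi B N0 pphi phi0 phic dB x; rewrite -/be -/(w x) => H.
  have t1 : 0 <= 1 - th by lra.
  apply: (le_trans (ler_wpM2l t1 H)).
  have -> : (1 - th) * (C2 * w x ^+ D * (N%:R * be)) = C2 * w x ^+ D * N%:R * (be - al).
    by rewrite -thbe; ring.
  apply: (le_trans (ler_wpM2l _ be_al)); first by rewrite !mulr_ge0.
  rewrite le_eqVlt; apply/orP; left; apply/eqP.
  rewrite [h ^+ k.+2]exprS [LHS](_ : _ = C2 * (C1 * C0 * C3) * h ^+ k.+1 * w x ^+ D * (N%:R * h)).
    by rewrite mulfV ?mulr1 // gt_eqF.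
  by ring.
pose q x := th * p x.
have qg x : `|q x - g x| <= C4 * h ^+ k.+1 * w x ^+ (K + D).
  have -> : q x - g x = - ((1 - th) * p x) + (p x - g x) by rewrite /q; ring.
  apply: (le_trans (ler_normD _ _)); rewrite normrN normrM ger0_norm; last by lra.
  rewrite [leRHS](_ : _ = C2 * (C1 * C0 * C3) * h ^+ k.+1 * w x ^+ (K + D) +
    C1 * h ^+ k.+1 * w x ^+ (K + D)); last by rewrite /C4; ring.
  apply: lerD.
    apply: (le_trans (grow x)); apply: ler_wpM2l; first by rewrite !mulr_ge0.
    by apply: ler_weXn2l => //; exact: leq_addl.
  apply: (le_trans (pe x)); apply: ler_wpM2l; first by apply: mulr_ge0.
  by apply: ler_weXn2l; [exact: w1|exact: leq_addr].
pose e x := (q x - g x) * phi (x - a).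
have ew x : `|e x| <= C5 * h ^+ k.+1 * ((w x)^-1 * (w x)^-1).
  rewrite /e normrM (ger0_norm (phia x)).
  apply: (le_trans (ler_pM _ _ (qg x) (phiw (x - a)))) => //; rewrite -/(w x).
  have -> : (K + D).+2 = (K + D + 2)%N by rewrite addn2.
  rewrite (exprD _ (K + D) 2); have ww : w x ^+ (K + D) != 0 by rewrite gt_eqF // exprn_gt0.
  have w0' := lt0r_neq0 (w0 x).
  rewrite le_eqVlt /C5; apply/orP; left; apply/eqP.
  by move: (w x ^+ (K + D)) ww (h ^+ k.+1) => X X0 Y; field; rewrite X0 w0'.
exists q; split; first exact: trig_polyZ.
  by move=> x; rewrite /q -mulrA mulr_ge0.
move=> E dE x /andP[x0 x2].
have S0 : 0 <= \sum_i (omega N (z i - a))^-1.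
  by apply: sumr_ge0 => i _; rewrite invr_ge0 ltW // omega_gt0.
set S := \sum_i _ in S0 *.
(* The integral of s (th |p| - |g|) against the kernel is 0 and may be subtracted. Where [P t] has
   the strict sign of [P a] it cancels the integrand exactly. Elsewhere |P a| <= |P t - P a|, and
   [far] replaces one factor 1 / [omega] by a multiple of [S]. *)
have hD : `|E (2 * pi) - E 0| <= 2 * C6 * (C5 * C3) * h ^+ k.+2 * S.
  pose s := Num.sg (P a).
  have s1 : `|s| <= 1 by rewrite /s normr_sg; case: (P a != 0).
  have dF := derB dE (derZ s (derB (derZ th dB) dA)).
  have dG := derZ (2 * C6 * C5 * h ^+ k.+1 * S) dW.
  have := der_norm_le dF dG pp; rewrite -mulrBr => H.
  have -> : E (2 * pi) - E 0 = (E (2 * pi) - s * (th * B (2 * pi) - A (2 * pi))) -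
      (E 0 - s * (th * B 0 - A 0)).
    rewrite [RHS](_ : _ = E (2 * pi) - E 0 - s * (th * be - al)); last by rewrite /be /al; ring.
    by rewrite thbe subrr mulr0 subr0.
  apply: (le_trans (H _)); last first.
    have -> : 2 * C6 * (C5 * C3) * h ^+ k.+2 * S = 2 * C6 * C5 * h ^+ k.+1 * S * (C3 * h).
      by rewrite exprSr; ring.
    by apply: ler_wpM2l => //; do ![apply: mulr_ge0 => //].
  move=> t _; rewrite -/(e t).
  have ebar : `|th * (`|p t| * phi (t - a)) - `|g t| * phi (t - a)| <= `|e t|.
    rewrite mulrA -mulrBl /e !normrM; apply: ler_wpM2r; first exact: normr_ge0.
    have -> : th * `|p t| = `|q t| by rewrite /q normrM (ger0_norm th0).
    exact: ler_dist_dist.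
  have rhs0 : 0 <= 2 * C6 * C5 * h ^+ k.+1 * S * (w t)^-1.
    by do ![apply: mulr_ge0 => //].
  case: (ltrP 0 (P t * P a)) => sgn.
    suff -> : e t - s * (th * (`|p t| * phi (t - a)) - `|g t| * phi (t - a)) = 0 by rewrite normr0.
    have np : `|p t| = s * p t /\ `|g t| = s * g t.
      rewrite /s; move: sgn (pP t) (gP t); case: (ltrgt0P (P a)) => Pa.
      - rewrite gtr0_sg // pmulr_lgt0 // => Pt; rewrite !pmulr_lge0 // => p_0 g_0.
        by rewrite !mul1r !ger0_norm.
      - rewrite ltr0_sg // nmulr_lgt0 // => Pt; rewrite !nmulr_lge0 // => p_0 g_0.
        by rewrite !mulN1r !ler0_norm.
      - by rewrite Pa mulr0 ltxx.
    have ss : s * s = 1.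
      rewrite /s; move: sgn; case: (ltrgt0P (P a)) => Pa.
      - by rewrite gtr0_sg // mulr1.
      - by rewrite ltr0_sg // mulrNN mulr1.
      - by rewrite Pa mulr0 ltxx.
    rewrite np.1 np.2 /e /q.
    have -> : (th * p t - g t) * phi (t - a) -
      s * (th * (s * p t * phi (t - a)) - s * g t * phi (t - a)) =
      (1 - s * s) * ((th * p t - g t) * phi (t - a)) by ring.
    by rewrite ss subrr mul0r.
  have far : 1 <= C6 * w t * S.
    have := zeros_far N a t; rewrite -/(w t) -/S => H1; apply: (le_trans H1).
    apply: ler_wpM2r => //; rewrite /C6 -mulrA; apply: ler_wpM2l.
      by rewrite addr_ge0 // exprn_even_ge0.
    have PPa : `|P a| <= LP * `|sin ((t - a) / 2)|.
      apply: le_trans (hLP t a); rewrite -(ler_pXn2r (ltn0Sn 1)) ?nnegrE //.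
      rewrite !real_normK ?num_real // sqrrB; have := sqr_ge0 (P t); lra.
    have : `|P a| ^+ 2 <= (LP * `|sin ((t - a) / 2)|) ^+ 2.
      by rewrite lerXn2r ?nnegrE ?mulr_ge0.
    rewrite real_normK ?num_real // exprMn => P2.
    have N2 : 0 <= N%:R ^+ 2 :> R by exact: exprn_even_ge0.
    have := ler_wpM2l N2 P2; rewrite /w omegaE exprMn; have := sqr_ge0 LP.
    by lra.
  apply: (le_trans (ler_normB _ _)); rewrite [X in _ + X]normrM.
  have : `|s| * `|th * (`|p t| * phi (t - a)) - `|g t| * phi (t - a)| <= `|e t|.
    by apply: le_trans ebar; rewrite ler_piMl.
  have e2 : `|e t| <= C6 * C5 * h ^+ k.+1 * S * (w t)^-1.
    apply: (le_trans (ew t)).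
    have f1 : (w t)^-1 * (w t)^-1 <= (w t)^-1 * (C6 * S).
      apply: ler_wpM2l => //; rewrite -[leLHS]mul1r ler_pdivrMr // mulrAC; exact: far.
    have := ler_wpM2l (_ : 0 <= C5 * h ^+ k.+1) f1; move=> H1.
    apply: (le_trans (H1 _)); first by rewrite mulr_ge0.
    by rewrite le_eqVlt; apply/orP; left; apply/eqP; ring.
  by move: e2; lra.
have side u v b : 0 <= u -> u <= v -> v <= 2 * pi -> 0 <= b ->
    (forall t, u <= t <= v -> (w t)^-1 <= b) ->
    `|E v - E u| <= C5 * C3 * h ^+ k.+2 * b.
  move=> u0 uv v2 b0 hb.
  have := der_norm_le dE (derZ (C5 * h ^+ k.+1 * b) dW) uv; rewrite -mulrBr => H.
  apply: (le_trans (H _)) => [t ht|].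
    apply: (le_trans (ew t)); rewrite -[leRHS]mulrA; apply: ler_wpM2l; first by rewrite mulr_ge0.
    by apply: ler_wpM2r => //; exact: hb.
  have -> : C5 * C3 * h ^+ k.+2 * b = C5 * h ^+ k.+1 * b * (C3 * h) by rewrite exprSr; ring.
  apply: ler_wpM2l; first by rewrite !mulr_ge0.
  by apply: le_trans hW; apply: lerB; exact: mW.
have w2 : w (2 * pi) = w 0.
  by have := omega_shift N 0 a 1; rewrite mulr1z mulr1 add0r.
set bx := (omega N (x - a))^-1; set b0 := (omega N (0 - a))^-1.
have bx0 : 0 <= bx by exact: wV.
have b00 : 0 <= b0 by exact: wV.
have C53 : 0 <= C5 * C3 * h ^+ k.+2 by do ![apply: mulr_ge0 => //].
have C53S : 0 <= C5 * C3 * h ^+ k.+2 * S by rewrite mulr_ge0.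
have C653 : 0 <= C6 * (C5 * C3 * h ^+ k.+2 * (bx + b0)).
  by do ![apply: mulr_ge0 => //]; exact: addr_ge0.
(* Up to [a] the tail [0, x] is used; beyond [a], the full integral minus the tail [x, 2 pi], whose
   right end has the weight of 0 by periodicity. *)
case: (lerP x a) => xa.
  have := side 0 x (bx + b0) (lexx 0) x0 x2 (addr_ge0 bx0 b00).
  have C653' : 0 <= C6 * (C5 * C3 * h ^+ k.+2 * S) by do ![apply: mulr_ge0 => //].
  move=> H; apply: (le_trans (H _)) => [t /andP[t0 tx]|]; last by lra.
  have [a0 a1] := andP a2.
  rewrite /bx /b0 /w !(omega_sub N _ a).
  by apply: omega_unimodal; rewrite ?subr_ge0 ?lerD2l ?lerN2 ?subr0.
have := side x (2 * pi) (bx + b0) x0 x2 (lexx _) (addr_ge0 bx0 b00).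
have -> : E x - E 0 = (E (2 * pi) - E 0) - (E (2 * pi) - E x) by ring.
move=> H; apply: (le_trans (ler_normB _ _)).
have := H _; move=> {}H.
apply: (le_trans (lerD hD (H _))) => [t /andP[t0 tx]|]; last by lra.
have [a0 a1] := andP a2.
rewrite /bx /b0 -/(w 0) -w2.
by apply: omega_unimodal; rewrite ?subr_ge0 ?lerD2r ?gerBl ?(ltW xa).
Qed.

(** By the partition of unity the total error is the sum of the cell errors. Summing over the nodes,
    each of the [n] zeros, the point x and the point 0 contributes at most [C0], independently of
    [N]. *)
Lemma sign_quasi k L : 0 <= L -> exists A (C : R), [/\ (0 < A)%N, 0 <= C &
  forall g, lipschitz_class k L g -> (forall i, g (z i) = 0) -> (forall x, 0 <= g x * P x) ->
  forall N, (0 < N)%N -> exists q, [/\ trig_poly (A * N) q, (forall x, 0 <= q x * P x) &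
    forall U, der U (fun x => q x - g x) -> forall x, 0 <= x <= 2 * pi ->
    `|U x - U 0| <= C * N%:R^-1 ^+ k.+2]].
Proof.
move=> L0; have [D [m [m0 hcell]]] := sign_cell k L0.
have [C0 [c [C0_0 c0 hker]]] := kernel_partition R m0.
have [C [C_0 {}hcell]] := hcell C0 c C0_0 c0.
exists (D + 2 * m)%N, (C * (n%:R * C0 + C0 + C0)); split.
- by rewrite addn_gt0 muln_gt0 m0 orbT.
- by rewrite mulr_ge0 // !addr_ge0 // mulr_ge0.
move=> g hg gz gP N N0.
have [M [phi [M0 tphi phi0 [phi1 phiw phic sumw]]]] := hker N N0.
have p0 : 0 < pi :> R := pi_gt0 R.
have node_in (j : 'I_M) : 0 <= (node M j : R) <= 2 * pi.
  have M0' : 0 < M%:R :> R by rewrite ltr0n.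
  have pp : 0 <= 2 * pi :> R by rewrite mulr_ge0 // ltW.
  apply/andP; split; first by rewrite /node divr_ge0 // mulr_ge0.
  by rewrite /node ler_pdivrMr // ler_wpM2l // ler_nat ltnW.
have cphi := trig_poly_continuous tphi.
have cshift b : continuous (fun x => phi (x - b)).
  exact: trig_poly_continuous (trig_poly_shift b tphi).
have [q hq] := fin_all_exists (fun j : 'I_M => hcell g hg gz gP N (node M j) phi N0 (node_in j)
  cphi (trig_poly_periodic tphi) phi0 phiw phic).
have cg := lipschitz_class_continuous hg.
have hE (j : 'I_M) : exists E, der E (fun x => (q j x - g x) * phi (x - node M j)).
  have [tq _ _] := hq j; apply: antiderivative => x.
  apply: cvgM; last exact: cshift.
  by apply: cvgB; [exact: (trig_poly_continuous tq)|exact: cg].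
have [E dE] := fin_all_exists hE.
exists (fun x => \sum_(j < M) q j x * phi (x - node M j)); split.
- apply: trig_poly_sum => j; have [tq _ _] := hq j.
  apply: (@trig_poly_widen _ (D + N * 2 * m)); last first.
    by apply: trig_polyM => //; exact: trig_poly_shift.
  by rewrite mulnDl leq_add // ?leq_pmulr // -mulnA mulnC.
- move=> x; rewrite mulr_suml; apply: sumr_ge0 => j _; have [_ qP _] := hq j.
  by rewrite mulrAC mulr_ge0.
move=> U dU x hx.
have dS := der_sum (index_enum 'I_M) xpredT dE.
have {}dS : der (fun x => \sum_(j < M) E j x) (fun x => \sum_(j < M) q j x * phi (x - node M j) - g x).
  apply: der_ext dS => t; rewrite -[in RHS](mulr1 (g t)) -(phi1 t) mulr_sumr -sumrB.
  by apply: eq_bigr => j _; rewrite mulrBl.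
rewrite (der_eq 0 x dU dS) -sumrB; apply: (le_trans (ler_norm_sum _ _ _)).
pose b (j : 'I_M) := \sum_i (omega N (z i - node M j))^-1 + (omega N (x - node M j))^-1 +
  (omega N (0 - node M j))^-1.
apply: (@le_trans _ _ (\sum_(j < M) C * N%:R^-1 ^+ k.+2 * b j)).
  by apply: ler_sum => j _; have [_ _] := hq j; apply.
rewrite -mulr_sumr mulrAC; apply: ler_wpM2r; first by rewrite exprn_ge0 // invr_ge0.
apply: ler_wpM2l => //; rewrite /b !big_split /= exchange_big /=.
apply: lerD => //; apply: lerD => //.
apply: (@le_trans _ _ (\sum_(i < n) C0)); first by apply: ler_sum => i _; exact: sumw.
by rewrite sumr_const card_ord mulr_natl.
Qed.

End SignPreservingApproximation.

(** * From an almost-everywhere derivative bound to a Lipschitz bound *)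

Section AbsoluteContinuity.
Variable R : realType.
Implicit Types (g : R -> R) (a b t x y e : R).
Let mu : {measure set (measurableTypeR R) -> \bar R} := @lebesgue_measure R.

Lemma derive_le_near g t e : 0 < e -> derivable g t 1 -> `|derive1 g t| <= 1 ->
  exists2 d : R, 0 < d & forall x, `|x - t| < d -> `|g x - g t| <= (1 + e) * `|x - t|.
Proof.
move=> e0 dg g1.
have cv : h^-1 *: (g (h *: 1 + t) - g t) @[h --> (0 : R)^'] --> derive1 g t.
  by rewrite derive1E; exact: dg.
have /cvgrPdist_le/(_ e e0) := cv.
rewrite near_withinE => /nbhs_ballP[d /= d0 hd]; exists d => // x xt.
have [->|xt0] := eqVneq x t; first by rewrite !subrr !normr0 mulr0.
have h0 : x - t != 0 by rewrite subr_eq0.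
have := hd (x - t); rewrite /ball /= sub0r normrN => /(_ xt h0).
rewrite [_ *: 1]mulr1 subrK => H.
have H1 : `|(x - t)^-1 *: (g x - g t)| <= 1 + e.
  have := ler_normB (derive1 g t) (derive1 g t - (x - t)^-1 *: (g x - g t)).
  by rewrite opprB addrCA subrr addr0; lra.
rewrite -ler_pdivrMr ?normr_gt0 // mulrC -normfV -normrM; exact: H1.
Qed.

(* A Cousin-type argument: an interval around an exceptional point lies in an open set of small
   measure, and there absolute continuity takes over from the derivative bound. *)
Lemma ac_lipschitz g : abs_continuous g ->
  {ae mu, forall x, derivable g x 1 /\ `|derive1 g x| <= 1} ->
  forall x y, `|g x - g y| <= `|x - y|.
Proof.
move=> acg [A [mA muA subA]].
suff key a b e : a <= b -> 0 < e -> `|g b - g a| <= (1 + e) * (b - a) + e.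
  move=> x y; wlog xy : x y / y <= x => [hw|].
    by case: (leP y x) => [|/ltW] xy; [exact: hw|rewrite distrC (distrC x); exact: hw].
  rewrite (ger0_norm (x := x - y)) ?subr_ge0 //; apply/ler_addgt0Pr => e e0.
  have c0 : 0 < 1 + (x - y) by rewrite ltr_pwDl // subr_ge0.
  apply: (le_trans (key y x (e / (1 + (x - y))) xy _)); first by rewrite divr_gt0.
  rewrite le_eqVlt; apply/orP; left; apply/eqP; field; by rewrite gt_eqF.
move=> ab e0.
have [d d0 hd] := acg a b e e0.
have [U [oU AU muU]] : exists U, [/\ open U, A `<=` U & (mu U < d%:E)%E].
  have [|U [oU AU muUA]] := lebesgue_regularity_outer mA _ d0.
    by rewrite -/mu muA ltry.
  exists U; split => //; rewrite (_ : U = A `|` (U `\` A)); last by rewrite setDUK.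
  have H : (mu (A `|` (U `\` A)) <= mu A + mu (U `\` A))%E.
    apply: measureU2 => //.
    by apply: measurableD => //; exact: measurable_realfun.open_measurable.
  by rewrite muA add0e in H; exact: le_lt_trans H muUA.
have mU : measurable U by exact: measurable_realfun.open_measurable.
(* Intervals crossed inside [U] are recorded. Their total length stays below the measure of [U],
   hence below [d], so absolute continuity finally bounds their contribution by [e]. *)
pose chain x := exists m (u v : nat -> R), [/\
  forall i, (i < m)%N -> [/\ a <= u i, u i <= v i & v i <= x],
  forall i j, (i < m)%N -> (j < m)%N -> i <> j -> v i <= u j \/ v j <= u i,
  ((\sum_(i < m) (v i - u i))%:E <= mu (U `&` `]a, x]))%E &
  `|g x - g a| <= (1 + e) * (x - a) + \sum_(i < m) `|g (v i) - g (u i)|].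
have step_good x y : chain x -> x <= y -> `|g y - g x| <= (1 + e) * (y - x) -> chain y.
  move=> [m [u [v [h1 h2 h3 h4]]]] xy hg; exists m, u, v; split => //.
  - by move=> i /h1[? ? ?]; split => //; apply: le_trans xy.
  - apply: (le_trans h3); apply: le_measure; rewrite ?inE.
    + by apply: measurableI.
    + by apply: measurableI.
    + apply: setIS => z /=; rewrite !in_itv /= => /andP[-> zx]; exact: le_trans xy.
  - have := ler_normD (g y - g x) (g x - g a); rewrite addrA subrK => H.
    by apply: (le_trans H); lra.
have step_bad x y : chain x -> a <= x -> x <= y -> `[x, y]%classic `<=` U -> chain y.
  move=> [m [u [v [h1 h2 h3 h4]]]] ax xy xyU.
  exists m.+1, (fun i => if i == m then x else u i), (fun i => if i == m then y else v i); split.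
  - move=> i; rewrite ltnS leq_eqVlt; case: eqP => [_ _|_ /= im]; first by split.
    by have [? ? ?] := h1 i im; split => //; apply: le_trans xy.
  - move=> i j; rewrite !ltnS => im jm ij.
    case: (eqVneq i m) => [ei|ni]; case: (eqVneq j m) => [ej|nj].
    + by case: ij; rewrite ei ej.
    + by right; case: (h1 j) => //; rewrite ltn_neqAle nj.
    + by left; case: (h1 i) => //; rewrite ltn_neqAle ni.
    + by apply: h2 => //; rewrite ltn_neqAle ?ni ?nj.
  - rewrite big_ord_recr /= eqxx (eq_bigr (fun i : 'I_m => v i - u i)); last first.
      by move=> i _; rewrite ltn_eqF.
    apply: (@le_trans _ _ (mu ((U `&` `]a, x]) `|` `]x, y]))); last first.
      apply: le_measure; rewrite ?inE.
      + by apply: measurableU => //; apply: measurableI.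
      + by apply: measurableI.
      + move=> z /= [[Uz]|]; rewrite !in_itv /= => /andP[z1 z2].
          by split => //; rewrite z1 (le_trans z2).
        by split; [apply: xyU; rewrite /= in_itv /= ltW|rewrite (le_lt_trans ax) // z2].
    have mxy : mu `]x, y]%classic = (y - x)%:E.
      rewrite [LHS](lebesgue_measure_itv `]x, y]) /= lte_fin.
      by move: xy; rewrite le_eqVlt => /orP[/eqP ->|->] //; rewrite ltxx subrr.
    have -> : mu ((U `&` `]a, x]) `|` `]x, y]) = (mu (U `&` `]a, x]) + mu `]x, y]%classic)%E.
      apply: measureU => //; first by apply: measurableI.
      apply/seteqP; split => // z /= [[_]]; rewrite !in_itv /= => /andP[_ z1] /andP[z2 _].
      by move: (lt_le_trans z2 z1); rewrite ltxx.
    by rewrite mxy EFinD; apply: leeD.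
  - rewrite big_ord_recr /= eqxx (eq_bigr (fun i : 'I_m => `|g (v i) - g (u i)|)); last first.
      by move=> i _; rewrite ltn_eqF.
    have := ler_normD (g y - g x) (g x - g a); rewrite addrA subrK => H.
    apply: (le_trans H).
    have : (1 + e) * (x - a) <= (1 + e) * (y - a) by rewrite ler_wpM2l ?lerB //; lra.
    by lra.
have local t : exists2 r : R, 0 < r & forall x y, a <= x -> x <= t -> t <= y ->
    `|x - t| < r -> `|y - t| < r -> chain x -> chain y.
  case: (pselect (U t)) => Ut.
    have /nbhs_ballP[r /= r0 hr] : nbhs t U by exact: open_nbhs_nbhs.
    exists r => // x y ax xt ty xr yr cx.
    apply: (step_bad x y cx ax (le_trans xt ty)) => s /=; rewrite in_itv /= => /andP[xs sy].
    apply: hr; rewrite /ball /= ltr_norml; move: xr yr; rewrite !ltr_norml; lra.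
  have [dt g1] : derivable g t 1 /\ `|derive1 g t| <= 1.
    by apply: contrapT => nt; apply: Ut; apply: AU; exact: subA.
  have [r r0 hr] := derive_le_near e0 dt g1.
  exists r => // x y ax xt ty /hr hx /hr hy cx.
  apply: (step_good x y cx (le_trans xt ty)).
  have := ler_normB (g y - g t) (g x - g t).
  rewrite (_ : g y - g t - (g x - g t) = g y - g x); last by ring.
  move=> H; apply: (le_trans H); move: hx hy; rewrite (@ler0_norm _ (x - t)) ?subr_le0 //.
  rewrite (@ger0_norm _ (y - t)) ?subr_ge0 //.
  by lra.
have [m [u [v [h1 h2 h3 h4]]]] : chain b.
  (* By [local], the supremum of [Q] can be crossed from a chain point just below it, which would
     exceed the supremum unless [b] has been reached. *)
  pose Q := [set x | a <= x <= b /\ chain x].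
  have Qa : Q a.
    split; first by rewrite lexx.
    exists 0%N, (fun=> 0), (fun=> 0); split => //; first by rewrite big_ord0.
    by rewrite !subrr normr0 mulr0 big_ord0 addr0.
  have hQ : has_sup Q by split; [exists a|exists b => x [/andP[_ xb] _]].
  have [r r0 hr] := local (sup Q).
  have asup : a <= sup Q by apply: (ub_le_sup hQ.2).
  have [x [/andP[ax xb] cx] xs] := sup_adherent r0 hQ.
  have xsup : x <= sup Q by apply: (ub_le_sup hQ.2); split => //; rewrite ax.
  have supb : sup Q <= b by apply: ge_sup; [exists a|move=> z [/andP[_ zb] _]].
  pose y := Num.min b (sup Q + r / 2).
  have supy : sup Q <= y by rewrite le_min supb lerDl divr_ge0 // ltW.
  have yb : y <= b by rewrite ge_min lexx.
  have yr : y <= sup Q + r / 2 by rewrite ge_min lexx orbT.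
  have cy : chain y.
    apply: (hr x y ax xsup supy _ _ cx).
      by rewrite ltr_norml; lra.
    by rewrite ltr_norml; lra.
  have ysup : y <= sup Q.
    by apply: (ub_le_sup hQ.2); split => //; rewrite yb (le_trans asup).
  suff <- : y = b by [].
  apply/eqP; rewrite eq_le yb /=; move: ysup; rewrite /y ge_min => /orP[H|]; last by lra.
  by rewrite le_min lexx /=; lra.
have hsum : \sum_(i < m) (v i - u i) < d.
  rewrite -lte_fin; apply: (le_lt_trans h3); apply: le_lt_trans muU.
  by apply: le_measure; rewrite ?inE //; apply: measurableI.
have := hd m u v _ h2 hsum; move=> H.
apply: (le_trans h4); rewrite lerD2l ltW // H // => i /h1[a1 a2 a3]; by split.
Qed.

End AbsoluteContinuity.

(** * The sine product: its zeros, its lower bound, and polynomials of its sign with prescribed sign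
    of the mean *)

Section SineProduct.
Variables (R : realType) (s : nat) (y : nat -> R).
Hypotheses (s0 : (0 < s)%N) (Y : admissibleY s y).

Let z (i : 'I_s.*2) : R := y i.+1.
(** Fundamental functions of interpolation at the zeros. The squares are needed because a product of
    2s - 1 half-angle sines is not 2 pi-periodic. *)
Let ell (i : 'I_s.*2) (x : R) : R :=
  \prod_(j < s.*2 | j != i) (sin ((z i - z j) / 2) ^- 2 * sin ((x - z j) / 2) ^+ 2).

Lemma PiYE x : PiY s y x = \prod_(i < s.*2) sin ((x - z i) / 2).
Proof. by rewrite /PiY big_add1 big_mkord mul2n. Qed.

Lemma zero_lt i j : (0 < i < j)%N -> (j <= 2 * s)%N -> y j < y i.
Proof.
case: Y => _ dec _; move=> /andP[i0]; elim: j => // j IH; rewrite ltnS leq_eqVlt.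
move=> /orP[/eqP <-|ij] js; first by apply: dec.
apply: lt_trans (IH ij (ltnW js)); apply: dec => //; exact: leq_trans ij.
Qed.

Lemma zero_range i : (0 < i <= 2 * s)%N -> -pi <= y i < pi.
Proof.
case: (Y) => y1 _ y2 /andP[i0 iS]; apply/andP; split.
  move: iS; rewrite leq_eqVlt => /orP[/eqP -> //|iS].
  by apply: (le_trans y1); apply: ltW; apply: zero_lt; rewrite ?i0 ?iS.
case: (ltngtP 1 i) i0 => // [i1 _|<- //].
by apply: lt_trans y2; apply: zero_lt; rewrite ?i1.
Qed.

Lemma sin_zeros_neq0 i j : i != j -> 0 < `|sin ((z i - z j) / 2)|.
Proof.
have key (i' j' : 'I_s.*2) : (i' < j')%N -> 0 < `|sin ((z i' - z j') / 2)|.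
  move=> ij; rewrite normr_gt0 gt_eqF //; apply: sin_gt0_pi.
  have hi (k : 'I_s.*2) : (0 < k.+1 <= 2 * s)%N by rewrite mul2n ltn_ord.
  have /andP[a1 a2] := zero_range (hi i'); have /andP[b1 b2] := zero_range (hi j').
  have : z j' < z i' by apply: zero_lt => //; rewrite mul2n ltn_ord.
  by rewrite /z in a1 a2 b1 b2 *; lra.
rewrite neq_ltn => /orP[|]; first exact: key.
by move=> /key; rewrite -[z j - z i]opprB mulNr sinN normrN.
Qed.

Lemma ell_zero i j : ell i (z j) = (i == j)%:R.
Proof.
case: (eqVneq i j) => [<-|ij]; rewrite /ell.
  rewrite big1 // => k ki; rewrite mulVf // expf_neq0 //.
  by rewrite -normr_gt0 sin_zeros_neq0 // eq_sym.
by rewrite (bigD1 j) ?(eq_sym j) //= subrr mul0r sin0 expr0n mulr0 mul0r.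
Qed.

Lemma size_index_ord n : size (index_enum 'I_n) = n.
Proof. by rewrite -sum1_size big_const_ord iter_addn_0 mul1n. Qed.

Lemma half_form_prod_sin (r : seq 'I_s.*2) :
  half_form (size r) (fun x => \prod_(i <- r) sin ((x - z i) / 2)).
Proof.
elim: r => [|i r IH]; first by exists 1; apply: funext => x; rewrite big_nil.
have := half_formM (half_form_sin (z i)) IH; rewrite add1n; congr half_form.
by apply: funext => x; rewrite big_cons.
Qed.

Lemma trig_poly_PiY : trig_poly s.*2 (PiY s y).
Proof.
apply: (@trig_poly_widen _ s); first by rewrite -addnn leq_addr.
apply: half_form_trig_poly; have := half_form_prod_sin (index_enum 'I_s.*2).
rewrite size_index_ord.
by congr half_form; apply: funext => x; rewrite PiYE.
Qed.

Lemma trig_poly_ell i : trig_poly s.*2 (ell i).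
Proof.
have key (r : seq 'I_s.*2) : trig_poly (size r) (fun x => \prod_(j <- r | j != i)
    (sin ((z i - z j) / 2) ^- 2 * sin ((x - z j) / 2) ^+ 2)).
  elim: r => [|j r IH].
    have := trig_poly_cst 0 (1 : R); congr trig_poly.
    by apply: funext => x; rewrite big_nil.
  case: (boolP (j != i)) => ji; last first.
    have := trig_poly_widen (leqnSn _) IH; congr trig_poly.
    by apply: funext => x; rewrite big_cons (negbTE ji).
  have := trig_polyM (trig_polyZ (sin ((z i - z j) / 2) ^- 2) (trig_poly_sin_half2 (z j))) IH.
  by rewrite add1n; congr trig_poly; apply: funext => x; rewrite big_cons ji.
by have := key (index_enum 'I_s.*2); rewrite size_index_ord.
Qed.

(** Choose the zero whose factor is smallest: since the zeros are separated, every other factor is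
    at least half the separation. The product [sg] over all pairs serves as the separation, as each
    of its factors is at most 1. *)
Lemma PiY_lower : exists cP : R, forall x, exists i, `|sin ((x - z i) / 2)| <= cP * `|PiY s y x|.
Proof.
pose sg : R := \prod_(q : 'I_s.*2 * 'I_s.*2 | q.1 != q.2) `|sin ((z q.1 - z q.2) / 2)|.
have sg0 : 0 < sg by apply: prodr_gt0 => -[i j] /= ij; exact: sin_zeros_neq0.
have sgle i j : i != j -> sg <= `|sin ((z i - z j) / 2)|.
  move=> ij; rewrite /sg (bigD1 (i, j)) //= ler_piMr //.
  by apply: prodr_ile1 => q _; rewrite normr_ge0 sin_max.
pose e := Num.min (sg / 2) 1.
have e0 : 0 < e by rewrite lt_min divr_gt0 ?ltr01.
have e1 : e <= 1 by rewrite ge_min lexx orbT.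
exists (e ^- s.*2) => x.
have i0 : 'I_s.*2 by exists 0%N; rewrite double_gt0.
case: (@arg_minP _ _ _ i0 xpredT (fun i => `|sin ((x - z i) / 2)|) isT) => i _ hmin.
exists i; rewrite [leRHS]mulrC ler_pdivlMr ?exprn_gt0 // PiYE normr_prod (bigD1 i) //=.
apply: ler_wpM2l => //.
apply: (@le_trans _ _ (\prod_(j < s.*2 | j != i) e)).
  rewrite prodr_const; apply: ler_wiXn2l => //; first exact: ltW.
  by apply: (leq_trans (max_card _)); rewrite card_ord.
apply: ler_prod => j ji; rewrite (ltW e0) /=.
have := sgle i j; rewrite eq_sym => /(_ ji) h1.
have h2 : `|sin ((z i - z j) / 2)| <= `|sin ((x - z j) / 2)| + `|sin ((x - z i) / 2)|.
  have -> : (z i - z j) / 2 = (x - z j) / 2 - (x - z i) / 2 by lra.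
  rewrite sinB; apply: (le_trans (ler_normB _ _)); rewrite !normrM.
  by apply: lerD; [rewrite ler_piMr // cos_max|rewrite ler_piMl // cos_max].
by have h3 := hmin j isT; rewrite ge_min; apply/orP; left; lra.
Qed.

(** Between y_1 and pi all factors are positive; between y_2 and y_1 exactly the first one is
    negative. *)
Lemma PiY_takes_sign (e : R) : e = 1 \/ e = -1 -> exists x, 0 < e * PiY s y x.
Proof.
have s2 : (1 <= 2 * s)%N by rewrite mul2n double_gt0.
have y1 : y 1%N < pi by case: Y.
have hi (i : 'I_s.*2) : (0 < i.+1 <= 2 * s)%N by rewrite mul2n ltn_ord.
case=> ->.
  exists ((y 1%N + pi) / 2); rewrite mul1r PiYE; apply: prodr_gt0 => i _.
  apply: sin_gt0_pi; have /andP[] := zero_range (hi i).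
  have : y i.+1 <= y 1%N.
    by case: (nat_of_ord i) (ltn_ord i) => // i' i's; apply/ltW/zero_lt; rewrite // mul2n.
  by rewrite /z; lra.
have s22 : (2 <= 2 * s)%N by rewrite mul2n -(doubleS 0) leq_double.
have y21 : y 2%N < y 1%N by exact: zero_lt.
have i0P : (0 < s.*2)%N by rewrite -mul2n.
exists ((y 1%N + y 2%N) / 2); rewrite PiYE (bigD1 (Ordinal i0P)) //= mulN1r -mulNr -sinN.
apply: mulr_gt0.
  apply: sin_gt0_pi; have /andP[] := zero_range (hi (Ordinal i0P)).
  have h2 : (0 < 2 <= 2 * s)%N by [].
  have /andP[] := zero_range h2.
  by rewrite /z /=; lra.
apply: prodr_gt0 => i i1; apply: sin_gt0_pi; have /andP[] := zero_range (hi i).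
have : y i.+1 <= y 2%N.
  move: i1; case: i => -[//|[//|i]] hi' _ /=.
  by apply/ltW/zero_lt => //; rewrite mul2n.
by rewrite /z; lra.
Qed.

(** Multiplied by the factors other than the i-th, [g] becomes a continuous [u] with u sin ((x - z
    i) / 2) >= 0. The sine changes sign at [z i], so [u] cannot keep a strict sign there. *)
Lemma vanish_at_zeros (g : R -> R) : continuous g -> (forall x, 0 <= g x * PiY s y x) ->
  forall i, g (z i) = 0.
Proof.
move=> cg gP i.
pose Q x : R := \prod_(j < s.*2 | j != i) sin ((x - z j) / 2).
have Qz : Q (z i) != 0.
  by apply/prodf_neq0 => j ji; rewrite -normr_gt0 sin_zeros_neq0 // eq_sym.
have PQ x : PiY s y x = sin ((x - z i) / 2) * Q x by rewrite PiYE (bigD1 i).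
have cQ : continuous Q.
  have key (r : seq 'I_s.*2) : continuous (fun x => \prod_(j <- r | j != i) sin ((x - z j) / 2)).
    elim: r => [|j r IH].
      rewrite (_ : (fun x => _) = fun=> 1); last by apply: funext => x; rewrite big_nil.
      by move=> x; exact: cvg_cst.
    case: (boolP (j != i)) => ji; last first.
      rewrite (_ : (fun x => _) = fun x => \prod_(j <- r | j != i) sin ((x - z j) / 2)) //.
      by apply: funext => x; rewrite big_cons (negbTE ji).
    rewrite (_ : (fun x => _) =
      fun x => sin ((x - z j) / 2) * \prod_(j <- r | j != i) sin ((x - z j) / 2)).
      move=> x; apply: cvgM; last exact: IH.
      apply: continuous_comp; last exact: continuous_sin.
      by apply: cvgMl; apply: cvgB; [exact: cvg_id|exact: cvg_cst].
    by apply: funext => x; rewrite big_cons ji.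
  exact: key.
pose u x := g x * Q x.
have cu : continuous u by move=> x; apply: cvgM; [exact: cg|exact: cQ].
have uP x : 0 <= u x * sin ((x - z i) / 2).
  by have := gP x; rewrite PQ /u [sin _ * _]mulrC mulrA.
have small (b : R) : 0 < b < 1 -> 0 < sin (b / 2).
  by move=> hb; apply: sin_gt0_pi; have := pi_ge2 R; lra.
have u0 : u (z i) = 0.
  apply/eqP; rewrite eq_le; apply/andP; split; rewrite leNgt; apply/negP => h.
    have hn : \forall t \near z i, 0 < u t.
      exact: (@cvgr_gt _ _ _ _ _ _ (cu (z i)) 0 h).
    have /nbhs_ballP[r /= r0 hr] := hn.
    pose b := Num.min (r / 2) (1 / 2).
    have b0 : 0 < b by rewrite lt_min !divr_gt0.
    have b1 : b <= 1 / 2 by rewrite ge_min lexx orbT.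
    have br : b <= r / 2 by rewrite ge_min lexx.
    have := hr (z i - b); rewrite /ball /= opprB addrCA subrr addr0 gtr0_norm // => /(_ ltac:(lra)) ub.
    have := uP (z i - b); rewrite addrAC subrr add0r mulNr sinN mulrN oppr_ge0.
    by rewrite leNgt mulr_gt0 // small // b0; lra.
  have hn : \forall t \near z i, u t < 0.
    exact: (@cvgr_lt _ _ _ _ _ _ (cu (z i)) 0 h).
  have /nbhs_ballP[r /= r0 hr] := hn.
  pose b := Num.min (r / 2) (1 / 2).
  have b0 : 0 < b by rewrite lt_min !divr_gt0.
  have b1 : b <= 1 / 2 by rewrite ge_min lexx orbT.
  have br : b <= r / 2 by rewrite ge_min lexx.
  have := hr (z i + b); rewrite /ball /= opprD addrA subrr add0r normrN gtr0_norm // => /(_ ltac:(lra)) ub.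
  have := uP (z i + b); rewrite addrAC subrr add0r leNgt nmulr_rlt0 // small // b0; lra.
by move: u0 => /eqP; rewrite mulf_eq0 (negbTE Qz) orbF => /eqP.
Qed.

Lemma sign_quasi_PiY k L : 0 <= L -> exists A (C : R), [/\ (0 < A)%N, 0 <= C &
  forall g, lipschitz_class k L g -> (forall x, 0 <= g x * PiY s y x) ->
  forall N, (0 < N)%N -> exists q, [/\ trig_poly (A * N) q, (forall x, 0 <= q x * PiY s y x) &
    forall U, der U (fun x => q x - g x) -> forall x, 0 <= x <= 2 * pi ->
    `|U x - U 0| <= C * N%:R^-1 ^+ k.+2]].
Proof.
move=> L0; have [cP hP] := PiY_lower.
have [A [C [A0 C0 H]]] := sign_quasi trig_poly_PiY trig_poly_ell ell_zero hP k L0.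
exists A, C; split=> // g hg gP; apply: H => //.
by apply: vanish_at_zeros => //; exact: lipschitz_class_continuous hg.
Qed.

(** The function approximated, e times the positive part of [e * PiY], is only Lipschitz, hence
    [k = 0]. [N] is taken so large that the error C / N^2 stays below the integral [c] of that
    positive part. *)
Lemma sign_bump (e : R) : e = 1 \/ e = -1 -> exists n B, [/\ trig_poly n B,
  (forall x, 0 <= B x * PiY s y x) & forall V, der V B -> 0 < e * (V (2 * pi) - V 0)].
Proof.
move=> he; have [LP LP0 hLP] := trig_poly_lipschitz trig_poly_PiY.
have ee : e * e = 1 by case: he => ->; ring.
have ne : `|e| = 1 by case: he => ->; rewrite ?normrN normr1.
pose u x := Num.max (e * PiY s y x) 0.
have u0 x : 0 <= u x by rewrite le_max lexx orbT.
have pu : periodic2pi u by move=> x; rewrite /u (trig_poly_periodic trig_poly_PiY).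
have Lu x t : `|u x - u t| <= LP * `|x - t|.
  apply: le_trans (hLP x t); rewrite -[leRHS]mul1r -ne -normrM mulrBr /u.
  move: (e * PiY s y t) (e * PiY s y x) => b a; case: (leP a 0) => a0; case: (leP b 0) => b0.
  - by rewrite subrr normr0.
  - by rewrite sub0r normrN (gtr0_norm b0) distrC; apply: le_trans (ler_norm _); lra.
  - by rewrite subr0 (gtr0_norm a0); apply: le_trans (ler_norm _); lra.
  - by [].
have cu := lipschitz_continuous Lu.
have hg : lipschitz_class 0 LP (fun x => e * u x).
  split; first by move=> x; rewrite pu.
  by move=> x t; rewrite -mulrBr normrM ne mul1r.
have gP x : 0 <= e * u x * PiY s y x.
  rewrite mulrAC /u; case: (leP (e * PiY s y x) 0) => h; first by rewrite mulr0.
  by rewrite mulr_ge0 // ltW.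
have [A [C [A0 C0 H]]] := sign_quasi_PiY 0 LP0.
have [G dG] := antiderivative cu.
have p0 : 0 < pi :> R := pi_gt0 R.
pose c := G (2 * pi) - G 0.
have c0 : 0 < c.
  have [x0 hx0] := PiY_takes_sign he.
  rewrite /c -(der_period (x0 - pi) dG pu) subr_gt0.
  apply: (der_lt (c := x0) dG u0); first by lra.
  by rewrite lt_max hx0.
pose N := (Num.truncn (C / c)).+1.
have [q [tq qP hq]] := H _ hg gP N isT.
exists (A * N)%N, q; split => // V dV.
have pp : 0 <= 2 * (pi : R) <= 2 * pi by rewrite lexx mulr_ge0 // ltW.
have := hq _ (derB dV (derZ e dG)) _ pp.
have -> : V (2 * pi) - e * G (2 * pi) - (V 0 - e * G 0) = e * (e * (V (2 * pi) - V 0) - c).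
  by rewrite mulrBr mulrA ee mul1r /c; ring.
rewrite normrM ne mul1r => H1.
have N0 : 0 < N%:R :> R by rewrite ltr0n.
have hN : C * N%:R^-1 ^+ 2 < c.
  apply: (@le_lt_trans _ _ (C * N%:R^-1)).
    have i0 : 0 <= N%:R^-1 :> R by rewrite invr_ge0 ltW.
    have i1 : N%:R^-1 <= 1 :> R by rewrite invf_le1 // ler1n.
    by rewrite ler_wpM2l // expr2 ler_piMr.
  rewrite ltr_pdivrMr // mulrC -ltr_pdivrMr //; exact: truncnS_gt.
have := le_lt_trans H1 hN; rewrite ltr_norml; lra.
Qed.

End SineProduct.

(** * Correction of the mean and the comonotone Jackson estimate *)

Section Jackson.
Variable R : realType.
Implicit Types (f g F u : R -> R) (a b x y L : R) (k n : nat).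

Lemma der_periodic F u : der F u -> periodic2pi F -> periodic2pi u.
Proof.
move=> dF pF x; have := der_affine (2 * pi) 1 dF.
rewrite (_ : (fun x => _) = F) => [|]; last by apply: funext => t; rewrite mul1r pF.
by move=> /(_ x)/@derive_val; rewrite (@derive_val _ _ _ _ _ _ _ (dF x)) !mul1r.
Qed.

Lemma derivable_der F : (forall x, derivable F x 1) -> der F (derive1 F).
Proof. by move=> dF x; rewrite derive1E; exact: derivableP. Qed.

Lemma lipschitz_class_derive1n k L F : periodic2pi F ->
  (forall j, (j < k)%N -> forall x, derivable (derive1n j F) x 1) ->
  (forall x y, `|derive1n k F x - derive1n k F y| <= L * `|x - y|) -> lipschitz_class k L F.
Proof.
elim: k F => [|k IH] F pF dF LF; split => //.
have d0 := derivable_der (dF 0%N isT).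
exists (derive1 F) => //; apply: IH.
- exact: der_periodic d0 pF.
- by move=> j jk x; have := dF j.+1 jk x; rewrite derive1Sn.
- by move=> x y; have := LF x y; rewrite derive1Sn.
Qed.

(** The mean value theorem over a period gives a zero of g', so a bound on the oscillation of g'
    bounds g' itself. *)
Lemma lipschitz_class_osc k L : 0 <= L -> exists2 B : R, 0 <= B &
  forall g, lipschitz_class k L g -> forall x y, `|g x - g y| <= B.
Proof.
move=> L0; have p0 : 0 < pi :> R := pi_gt0 R.
elim: k => [|k [B B0 IH]].
  exists (L * pi); first by rewrite mulr_ge0 // ltW.
  move=> g [pg hg] x y; have [v hv] := near_mod_2pi y x.
  by rewrite -(periodic2piz x v pg); apply: (le_trans (hg _ _)); rewrite ler_wpM2l.
exists (B * pi); first by rewrite mulr_ge0 // ltW.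
move=> g [pg [g' dg hg']] x y; have [v hv] := near_mod_2pi y x.
rewrite -(periodic2piz x v pg).
have pp : 0 <= 2 * pi :> R by rewrite mulr_ge0 // ltW.
have [c _] := der_MVT dg pp; rewrite -{1}[2 * pi]add0r pg subrr subr0 => /eqP.
rewrite eq_sym mulf_eq0 [X in _ || X]gt_eqF ?mulr_gt0 // orbF => /eqP g'c.
apply: (le_trans (der_lip (C := B) dg _)) => [t _|]; last by rewrite ler_wpM2l.
by have := IH _ hg' t c; rewrite g'c subr0.
Qed.

Lemma En1_le n s (y : nat -> R) f t u b : trig_poly n t -> der t u -> continuous u ->
  (forall x, 0 <= u x * PiY s y x) -> (forall x, `|f x - t x| <= b) ->
  (En1 n s y f <= b%:E)%E.
Proof.
move=> tt dt cu uP ft.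
have eu : derive1 t = u.
  by apply: funext => x; rewrite derive1E; exact: (@derive_val _ _ _ _ _ _ _ (dt x)).
apply: (@le_trans _ _ (unorm (fun x => f x - t x))).
  apply: ereal_inf_lbound; exists t => //; split => //; split; rewrite ?eu //.
  by move=> x; exact: (@ex_derive _ _ _ _ _ _ _ (dt x)).
by apply: ub_ereal_sup => _ [x _ <-]; rewrite lee_fin.
Qed.

Lemma W_lipschitz_class r f : W r.+1 f -> lipschitz_class r 1 f.
Proof.
move=> [pf df acf aef]; apply: lipschitz_class_derive1n => // x y.
by rewrite mul1r; exact: ac_lipschitz.
Qed.

Lemma comonotone_jackson s (y : nat -> R) : (0 < s)%N -> admissibleY s y ->
  forall k, exists c : R, forall f g, lipschitz_class k.+1 1 f -> lipschitz_class k 1 g ->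
  der f g -> (forall x, 0 <= g x * PiY s y x) ->
  forall n, (0 < n)%N -> (En1 n s y f <= (c / n%:R ^+ k.+2)%:E)%E.
Proof.
move=> s0 Y k; have [A [C [A0 C0 quasi]]] := sign_quasi_PiY s0 Y k (@ler01 R).
have [Bo Bo0 osc] := lipschitz_class_osc k.+1 (@ler01 R).
(* [be] is taken relative to the slope [e * b], so that cancelling a mean [b'] by a multiple of the
   bump costs [be * |b'|]. *)
have bump (e : R) : e = 1 \/ e = -1 -> exists n b T B be, [/\ trig_poly n T, trig_poly n B,
    der (fun x => b * x + T x) B, (forall x, 0 <= B x * PiY s y x) &
    [/\ 0 <= be, 0 < e * b & forall x, 0 <= x <= 2 * pi -> `|b * x + T x - T 0| <= be * (e * b)]].
  move=> he; have [n [B [tB BP hB]]] := sign_bump s0 Y he.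
  have [b [T tT dT]] := trig_poly_antiderivative tB.
  have eb : 0 < e * b.
    have := hB _ dT; rewrite -[in T _](add0r (2 * pi)) (trig_poly_periodic tT) mulr0 add0r addrK.
    by rewrite mulrA pmulr_lgt0 // mulr_gt0 // pi_gt0.
  have [be be0 hbe] := trig_poly_bounded tB.
  have pp := pi_gt0 R.
  exists n, b, T, B, (be * (2 * pi) / (e * b)); split=> //; split=> //.
    by apply: divr_ge0; [apply: mulr_ge0 => //; lra|exact: ltW].
  move=> x /andP[x0 x2]; rewrite divfK ?gt_eqF //.
  have := @der_lip _ _ _ 0 x be dT (fun t _ => hbe t); rewrite mulr0 add0r subr0 (ger0_norm x0).
  by move=> H; apply: (le_trans H); rewrite ler_wpM2l.
have [n1 [b1 [T1 [B1 [be1 [tT1 tB1 dT1 BP1 [be1_0 eb1 hbe1]]]]]]] := bump 1 (or_introl erefl).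
have [n2 [b2 [T2 [B2 [be2 [tT2 tB2 dT2 BP2 [be2_0 eb2 hbe2]]]]]]] := bump (-1) (or_intror erefl).
(* For n >= [m] both bumps have order at most n, and N = n / m satisfies A N <= n as well as n <= 2
   m N. *)
pose m := (A + n1 + n2)%N.
have m0 : (0 < m)%N by rewrite /m !addn_gt0 A0.
pose c1 := C * (1 + (be1 + be2)).
have c1_0 : 0 <= c1 by rewrite mulr_ge0 // !addr_ge0.
pose c := c1 * (2 * m%:R) ^+ k.+2 + Bo * m%:R ^+ k.+2.
exists c => f g hf hg dfg gP n n0.
have n0' : 0 < n%:R :> R by rewrite ltr0n.
have m0' : 0 < m%:R :> R by rewrite ltr0n.
have pf := lipschitz_class_periodic hf.
have p0 : 0 < pi :> R := pi_gt0 R.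
have pp : 0 <= (2 * pi : R) <= 2 * pi by rewrite lexx mulr_ge0 // ltW.
case: (ltnP n m) => nm.
  (* For small n a constant is an admissible competitor, its derivative being 0; the factor m^(k+2)
     in [c] compensates the missing decay. *)
  apply: (@le_trans _ _ Bo%:E).
    apply: (@En1_le _ _ _ _ (fun=> f 0) (fun=> 0)).
    - exact: trig_poly_cst.
    - exact: der_cst.
    - by move=> x; exact: cvg_cst.
    - by move=> x; rewrite mul0r.
    - by move=> x; exact: osc.
  rewrite lee_fin ler_pdivlMr ?exprn_gt0 // /c; apply: (@le_trans _ _ (Bo * m%:R ^+ k.+2)).
    by rewrite ler_wpM2l // lerXn2r ?nnegrE // ler_nat ltnW.
  by rewrite lerDr mulr_ge0 // exprn_ge0 // mulr_ge0.
pose N := (n %/ m)%N.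
have N0 : (0 < N)%N by rewrite divn_gt0.
have N0' : 0 < N%:R :> R by rewrite ltr0n.
have Nm : (N * m <= n)%N by exact: leq_trunc_div.
have AN : (A * N <= n)%N.
  by apply: leq_trans Nm; rewrite mulnC leq_mul2l /m -addnA leq_addr orbT.
have hN : N%:R^-1 <= 2 * m%:R / n%:R :> R.
  rewrite -[leLHS]mul1r ler_pdivrMr // mulrAC ler_pdivlMr // mul1r.
  rewrite -!natrM ler_nat; have := ltn_ceil n m0; rewrite -/N mulSn => h.
  have h' : (m + N * m <= 2 * m * N)%N.
    by rewrite -mulnA mul2n -addnn (mulnC N) leq_add2r leq_pmulr.
  exact: ltnW (leq_trans h h').
have [q [tq qP hq]] := quasi g hg gP N N0.
have [b [T tT dT]] := trig_poly_antiderivative tq.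
set h := C * N%:R^-1 ^+ k.+2 in hq.
have h0 : 0 <= h by rewrite mulr_ge0 // exprn_ge0 // invr_ge0.
(* Since [f] and [T] are periodic, the increment of the error over a full period is exactly b times
   2 pi. *)
have hb : `|b| * (2 * pi) <= h.
  have := hq _ (derB dT dfg) (2 * pi) pp.
  rewrite -[in T _](add0r (2 * pi)) -[in f _](add0r (2 * pi)) pf (trig_poly_periodic tT).
  have -> : b * (2 * pi) + T 0 - f 0 - (b * 0 + T 0 - f 0) = b * (2 * pi) by ring.
  by rewrite normrM [X in _ * X]ger0_norm //; case/andP: pp.
have [e [n' [b' [T' [B [be [tT' tB dT' BP [be0 eb hbe [n'n beb ebn]]]]]]]]] :
  exists e n' b' T' B be, [/\ trig_poly n' T', trig_poly n' B,
    der (fun x => b' * x + T' x) B, (forall x, 0 <= B x * PiY s y x) &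
    [/\ 0 <= be, 0 < e * b',
      forall x, 0 <= x <= 2 * pi -> `|b' * x + T' x - T' 0| <= be * (e * b') &
      [/\ (n' <= n)%N, be <= be1 + be2 & e * b = - `|b| /\ e * e = 1]]].
  have n1n : (n1 <= n)%N.
    by apply: leq_trans nm; rewrite /m addnAC leq_addl.
  have n2n : (n2 <= n)%N by apply: leq_trans nm; rewrite /m leq_addl.
  case: (lerP b 0) => b0.
    exists 1, n1, b1, T1, B1, be1; split=> //; split=> //; split=> //; first by rewrite lerDl.
    by rewrite !mul1r ler0_norm // opprK.
  exists (-1), n2, b2, T2, B2, be2; split=> //; split=> //; split=> //; first by rewrite lerDr.
  by rewrite mulN1r gtr0_norm // mulrNN mul1r.
case: ebn => eb_b ee.
pose lam := `|b| / (e * b').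
have lam0 : 0 <= lam by rewrite divr_ge0 // ltW.
have lamb : lam * (e * b') = `|b| by rewrite divfK // gt_eqF.
have mean0 : b + lam * b' = 0.
  have : e * (b + lam * b') = 0.
    by rewrite mulrDr eb_b mulrCA lamb addrC subrr.
  by move=> /(congr1 (fun t => e * t)); rewrite mulrA ee mul1r mulr0.
pose t0 x := T x + lam * T' x.
have dt0 : der t0 (fun x => q x + lam * B x).
  have := derD dT (derZ lam dT'); congr der; apply: funext => x.
  rewrite /t0 [LHS](_ : _ = (b + lam * b') * x + (T x + lam * T' x)); last by ring.
  by rewrite mean0 mul0r add0r.
have tt0 : trig_poly n t0.
  apply: trig_polyD; first exact: trig_poly_widen tT.
  by apply: trig_polyZ; exact: trig_poly_widen tT'.
have close x : 0 <= x <= 2 * pi -> `|f x - f 0 - (t0 x - t0 0)| <= c1 * N%:R^-1 ^+ k.+2.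
  move=> hx; have e1 := hq _ (derB dT dfg) x hx; have e2 := hbe x hx.
  have -> : f x - f 0 - (t0 x - t0 0) = - (b * x + T x - f x - (b * 0 + T 0 - f 0)) -
      lam * (b' * x + T' x - T' 0).
    apply/eqP; rewrite -subr_eq0 (_ : _ - _ = (b + lam * b') * x); last by rewrite /t0; ring.
    by rewrite mean0 mul0r.
  apply: (le_trans (ler_normB _ _)); rewrite normrN normrM (ger0_norm lam0).
  have e3 : lam * `|b' * x + T' x - T' 0| <= (be1 + be2) * h.
    apply: (le_trans (ler_wpM2l lam0 e2)).
    rewrite mulrCA lamb; apply: ler_pM => //.
    apply: le_trans hb; rewrite ler_peMr //; have := pi_ge2 R; lra.
  have -> : c1 * N%:R^-1 ^+ k.+2 = h + (be1 + be2) * h by rewrite /c1 /h; ring.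
  exact: lerD.
apply: (@En1_le _ _ _ _ (fun x => t0 x + (f 0 - t0 0)) (fun x => q x + lam * B x)).
- by apply: trig_polyD => //; exact: trig_poly_cst.
- by apply: der_ext (derD dt0 (der_cst (f 0 - t0 0))) => x; rewrite addr0.
- move=> x; apply: cvgD; first exact: (trig_poly_continuous tq).
  by apply: cvgMr; exact: (trig_poly_continuous tB).
- by move=> x; rewrite mulrDl addr_ge0 // -mulrA mulr_ge0.
move=> x.
have pt : periodic2pi (fun x => f x - (t0 x + (f 0 - t0 0))).
  by move=> u; rewrite pf (trig_poly_periodic tt0).
have [v hv] := near_mod_2pi pi x.
rewrite -(periodic2piz x v pt) /=; set x' := x + _ in hv *.
have hx' : 0 <= x' <= 2 * pi by move: hv; rewrite ler_norml; lra.
have -> : f x' - (t0 x' + (f 0 - t0 0)) = f x' - f 0 - (t0 x' - t0 0) by ring.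
apply: (le_trans (close x' hx')).
apply: (@le_trans _ _ (c1 * (2 * m%:R / n%:R) ^+ k.+2)).
  by rewrite ler_wpM2l // lerXn2r // nnegrE ?invr_ge0 // divr_ge0 // mulr_ge0.
rewrite expr_div_n mulrA ler_wpM2r ?invr_ge0 ?exprn_ge0 // /c lerDl.
by rewrite mulr_ge0 // exprn_ge0.
Qed.

End Jackson.

Theorem theorem1 (R : realType) (s : nat) (y : nat -> R) :
  (0 < s)%N -> admissibleY s y ->
  forall r : nat, (2 <= r)%N ->
  exists c : R, forall f : R -> R,
    Delta1 s y f -> W r f ->
    forall n : nat, (0 < n)%N ->
      (En1 n s y f <= (c / (n%:R ^+ r))%:E)%E.
Proof.
move=> s0 Y [//|[//|k]] _; have [c hc] := comonotone_jackson s0 Y k.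
exists c => f [df cf fP] Wf.
have hf := W_lipschitz_class Wf; have [_ [g dg hg]] := hf.
have eg : g = derive1 f.
  by apply: funext => x; rewrite derive1E; apply/esym; exact: (@derive_val _ _ _ _ _ _ _ (dg x)).
by apply: (hc f g) => // x; rewrite eg.
Qed.
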